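(* There exist an absolute constant $C>0$ and constants $c_1,c_2>0$ depending only on $(\tau,\kappa_1,\kappa_2,\kappa_u,l_0)$ such that the following holds. For any $t>0$ and any bandwidth $h$ satisfying $$ c_1\,\underline f^{-1} m_3^{1/2}\upsilon_0\sqrt{\frac{p+t}{n}}\ \le\ h\ \le\ c_2\,\underline f\, m_3^{-1/2}, $$ the smoothed quantile regression estimator $\hat{\boldsymbol\beta}_h$ satisfies, with probability at least $1-2e^{-t}$, $$ \|\hat{\boldsymbol\beta}_h-\boldsymbol\beta^*\|_{\boldsymbol\Sigma}\ \le\ \frac{C}{\underline f}\left\{\upsilon_0\sqrt{\frac{\log_2(1/h)+p+t}{n}}+l_0\kappa_2h^2\right\}. $$
   Context: Model: fix $\tau\in(0,1)$ and $p\ge 2$. Let $\boldsymbol x=(x_1,\dots,x_p)^{\top}$ be a random vector with $x_1\equiv1$ and $\mathbb E(x_j)=0$ for $j=2,\dots,p$, and $\boldsymbol\Sigma=\mathbb E(\boldsymbol x\boldsymbol x^{\top})$ positive definite. Let $y=\langle\boldsymbol x,\boldsymbol\beta^*\rangle+\varepsilon$ with $\boldsymbol\beta^*\in\mathbb R^p$ and $\mathbb P(\varepsilon\le0\mid\boldsymbol x)=\tau$; $f_{\varepsilon|\boldsymbol x}$ is the conditional density of $\varepsilon$ given $\boldsymbol x$. $(y_i,\boldsymbol x_i)$, $i=1,\dots,n$, are i.i.d. copies of $(y,\boldsymbol x)$. Estimator: $\rho_\tau(u)=u\{\tau-\mathbf 1(u<0)\}$, $K_h(u)=h^{-1}K(u/h)$,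 $\ell_h(u)=\int_{-\infty}^\infty\rho_\tau(v)K_h(v-u)\,dv$, $\hat Q_h(\boldsymbol\beta)=\frac1n\sum_{i=1}^n\ell_h(y_i-\langle\boldsymbol x_i,\boldsymbol\beta\rangle)$, and $\hat{\boldsymbol\beta}_h\in\arg\min_{\boldsymbol\beta\in\mathbb R^p}\hat Q_h(\boldsymbol\beta)$. Notation: $\|\boldsymbol u\|_{\boldsymbol\Sigma}=\|\boldsymbol\Sigma^{1/2}\boldsymbol u\|_2$; $\boldsymbol w=\boldsymbol\Sigma^{-1/2}\boldsymbol x$; $m_3=\sup_{\|\boldsymbol u\|_2=1}\mathbb E|\langle\boldsymbol u,\boldsymbol w\rangle|^3$; $\kappa_k=\int_{-\infty}^\infty|u|^kK(u)\,du$ (assumed finite for the $k$ that appear); $\log_2(x):=\log\log(x\vee e)$. Assumptions: (Kernel) $K$ is symmetric, non-negative, $\int K=1$, and $\kappa_u=\sup_uK(u)<\infty$. (Density) There are constants $\underline f>0$, $l_0>0$ such that $f_{\varepsilon|\boldsymbol x}(0)\ge\underline f$ almost surely and $|f_{\varepsilon|\boldsymbol x}(u)-f_{\varepsilon|\boldsymbol x}(v)|\le l_0|u-v|$ for all $u,v\in\mathbb R$ almost surely. (Sub-exponential design) There is $\upsilon_0>0$ such that $\mathbb P(|\langle\boldsymbol u,\boldsymbol w\rangle|\ge\upsilon_0t)\le2e^{-t}$ for all unit vectors $\boldsymbol u\in\mathbb R^p$ and $t\ge0$. *)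

(* Defs.v *)
From HB Require Import structures.
From mathcomp Require Import all_boot all_order all_algebra.
From mathcomp Require Import all_classical all_reals all_analysis.

Set Implicit Arguments.
Unset Strict Implicit.
Unset Printing Implicit Defensive.

Import Order.TTheory GRing.Theory Num.Theory.
Import numFieldNormedType.Exports.

Local Open Scope classical_set_scope.
Local Open Scope ring_scope.

Section Vectors.
Context {R : realType} {p : nat}.
Implicit Types (u v : 'cV[R]_p) (A S : 'M[R]_p).

(* Random vectors take values in [p.-tuple R], which carries the product
   (= Borel) sigma-algebra; [cvec] moves to column vectors for the algebra. *)
Definition cvec (a : p.-tuple R) : 'cV[R]_p := \col_i tnth a i.

Definition dot u v : R := \sum_i u i 0 * v i 0.

(* The library's norm on matrices is the sup norm. *)
Definition norm2 u : R := Num.sqrt (dot u u).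

Definition possemidef A : Prop := forall u, 0 <= dot u (A *m u).

Definition posdef A : Prop := forall u, u != 0 -> 0 < dot u (A *m u).

(* The unique symmetric positive semidefinite square root of a symmetric
   positive semidefinite matrix; the default [0] is never used on those. *)
Definition sqrtmx A : 'M[R]_p :=
  xget 0 [set S | [/\ S^T = S, possemidef S & S *m S = A]].

Definition wnorm A u : R := norm2 (sqrtmx A *m u).

End Vectors.

Section Kernel.
Context {R : realType}.
Notation mu := (@lebesgue_measure R).

Record kernel_assumption (K : R -> R) (kappa1 kappa2 kappau : R) : Prop := {
  kernel_measurable : measurable_fun setT K ;
  kernel_sym : forall u, K (- u) = K u ;
  kernel_ge0 : forall u, 0 <= K u ;
  kernel_int1 : (\int[mu]_u (K u)%:E = 1)%E ;
  kernel_kappa1 : (\int[mu]_u (`|u| * K u)%:E = kappa1%:E)%E ;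
  kernel_kappa2 : (\int[mu]_u (`|u| ^+ 2 * K u)%:E = kappa2%:E)%E ;
  kernel_kappau : ereal_sup (range (fun u => (K u)%:E)) = kappau%:E }.

Definition check_loss (tau u : R) : R := u * (tau - (u < 0)%R%:R).

Definition scaled_kernel (K : R -> R) (h u : R) : R := h^-1 * K (u / h).

Definition smoothed_loss (tau : R) (K : R -> R) (h u : R) : R :=
  \int[mu]_v (check_loss tau v * scaled_kernel K h (v - u)).

Definition smoothed_risk (tau : R) (K : R -> R) (h : R) {n p : nat}
    (ys : 'I_n -> R) (xs : 'I_n -> 'cV[R]_p) (b : 'cV[R]_p) : R :=
  n%:R^-1 * \sum_i smoothed_loss tau K h (ys i - dot (xs i) b).

Definition log2 (a : R) : R := ln (ln (Num.max a (expR 1))).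

End Kernel.

Section Probability.
Context {d : measure_display} {T : measurableType d} {R : realType}.
Variable P : probability T R.

(* [f v] is a version of the conditional density of [eps] given [X = v]. *)
Definition is_conditional_density {d'} {V : measurableType d'}
    (X : {RV P >-> V}) (eps : {RV P >-> R}) (f : V -> R -> R) : Prop :=
  [/\ measurable_fun [set: V * R] (fun z => f z.1 z.2),
      forall v u, 0 <= f v u &
      forall (D : set V) (B : set R), measurable D -> measurable B ->
        P (X @^-1` D `&` eps @^-1` B) =
        (\int[P]_(w in X @^-1` D)
           \int[@lebesgue_measure R]_(u in B) (f (X w) u)%:E)%E].

(* [P (eps \in B | X) = q] almost surely, for a constant [q]. *)
Definition cond_prob_cst {d'} {V : measurableType d'}
    (X : {RV P >-> V}) (eps : {RV P >-> R}) (B : set R) (q : R) : Prop :=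
  forall D : set V, measurable D ->
    P (X @^-1` D `&` eps @^-1` B) = (q%:E * P (X @^-1` D))%E.

Definition iid_copies {d'} {V : measurableType d'} {n : nat}
    (Z : T -> V) (Zs : 'I_n -> T -> V) : Prop :=
  (forall i (A : set V), measurable A -> P (Zs i @^-1` A) = P (Z @^-1` A)) /\
  (forall A : 'I_n -> set V, (forall i, measurable (A i)) ->
    P (\bigcap_i (Zs i @^-1` A i)) = (\prod_i P (Zs i @^-1` A i))%E).

Section Design.
Context {p : nat}.
Variable x : {RV P >-> p.-tuple R}.

Definition second_moment : 'M[R]_p :=
  \matrix_(i, j) fine ('E_P[fun w => (tnth (x w) i * tnth (x w) j)%R])%E.

Definition standardized (w : T) : 'cV[R]_p :=
  invmx (sqrtmx second_moment) *m cvec (x w).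

Definition m3 : R :=
  fine (ereal_sup [set ('E_P[fun w => (`|dot u (standardized w)| ^+ 3)%R])%E |
                   u in [set u : 'cV[R]_p | norm2 u = 1]]).

(* The coordinate of index 0 is the intercept. *)
Record design_assumption : Prop := {
  design_intercept :
    forall w (j : 'I_p), val j = 0%N -> tnth (x w) j = 1 ;
  design_L2 :
    forall j : 'I_p, P.-integrable setT (fun w => (tnth (x w) j ^+ 2)%:E) ;
  design_centered :
    forall j : 'I_p, val j != 0%N -> ('E_P[fun w => tnth (x w) j] = 0)%E ;
  design_posdef : posdef second_moment }.

Definition subexponential_design (upsilon0 : R) : Prop :=
  forall (u : 'cV[R]_p) (t : R), norm2 u = 1 -> 0 <= t ->
    (P [set w | (upsilon0 * t <= `|dot u (standardized w)|)%R] <=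
     (2 * expR (- t))%:E)%E.

Definition density_assumption (f : p.-tuple R -> R -> R) (flow l0 : R) : Prop :=
  {ae P, forall w, flow <= f (x w) 0} /\
  {ae P, forall w, forall u v, `|f (x w) u - f (x w) v| <= l0 * `|u - v|}.

End Design.

(* [bhat] is a measurable selection of the set of minimizers. *)
Definition is_sqr_estimator (tau : R) (K : R -> R) (h : R) {n p : nat}
    (ys : 'I_n -> {RV P >-> R}) (xs : 'I_n -> {RV P >-> p.-tuple R})
    (bhat : {RV P >-> p.-tuple R}) : Prop :=
  forall (w : T) (b : 'cV[R]_p),
    smoothed_risk tau K h (fun i => ys i w) (fun i => cvec (xs i w))
      (cvec (bhat w)) <=
    smoothed_risk tau K h (fun i => ys i w) (fun i => cvec (xs i w)) b.

End Probability.

(* Main.v *)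
Require Import Defs.
From HB Require Import structures.
From mathcomp Require Import all_boot all_order all_algebra.
From mathcomp Require Import all_classical all_reals all_analysis.
From mathcomp Require Import measurable_realfun.
From mathcomp Require Import ring lra.

(** Let [S] be the symmetric square root of the second-moment matrix of the
    design, and let [G u] be the empirical risk at [beta + invmx S *m u] minus
    the empirical risk at [beta].  [G] is convex, vanishes at 0 and is at most 0
    at the point that belongs to the estimator.  If [G] is positive on the sphere
    of radius [r], the estimation error, which is the norm of that point, is
    therefore at most [r] ([sphere_localization]).  The radius used is the
    claimed bound without its iterated logarithm, a nonnegative term that only
    enlarges the bound.  Positivity on the sphere holds on an event of
    probability at least [1 - expR (- t)] and has two sources.

    Curvature of the mean.  By Knight's identity an increment of the check loss is
    a linear term plus a nonnegative triangle ([check_loss_kink]).  The linear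
    term has mean zero given the design, because the conditional quantile of the
    noise is 0 ([quantile_orthogonal]).  Averaged over the kernel and integrated
    over a constant density, the triangles give exactly [v ^+ 2 / 2] for a shift
    [v], thanks to the symmetry of the kernel ([excess_integral]).  Since they
    live on a window of length of order [`|v| + h * `|s|], replacing the
    constant density by a Lipschitz one costs at most a multiple of
    [l0 * `|v| * (v ^+ 2 + h ^+ 2 * kappa2)].  Taking expectations over the
    design ([population_curvature]), the mean of [G] on the sphere is at least
    [flow / 2 * r ^+ 2] minus
    [4 * l0 * (m3 * r ^+ 3 + h ^+ 2 * kappa2 * r)].

    Deviation from the mean.  [G] is an empirical mean of functions that are
    Lipschitz in a linear form of the standardized covariates, so each of its
    increments obeys a Bernstein bound ([iid_deviation]).  Rounding the points of
    the sphere to nested dyadic grids and weighting the union bound by code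
    lengths that satisfy Kraft's inequality ([sum_code_cost]) controls all
    increments along the chains at once: [G] is below its mean by at most a
    multiple of [r * upsilon0 * sqrt ((p + t) / n)], uniformly on the sphere
    ([uniform_deviation]).

    The conditions on the bandwidth make the cubic term at most half of the
    quadratic one, and [r] is chosen so that the rest of the curvature beats the
    remaining linear terms ([radius_arithmetic]). *)

Set Implicit Arguments.
Unset Strict Implicit.
Unset Printing Implicit Defensive.

Import Order.TTheory GRing.Theory Num.Theory.
Import numFieldNormedType.Exports.

Local Open Scope classical_set_scope.
Local Open Scope ring_scope.

(** * Integrals of functions that factor through a random element *)

Section Transfer.
Local Open Scope ereal_scope.
Context d (V : measurableType d) (R : realType).
Import HBNNSimple.

Lemma integral_nnsfun_weight d1 (T : measurableType d1)
    (m : {measure set T -> \bar R}) (X : T -> V) (G : T -> R)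
    (f : {nnsfun V >-> R}) :
  measurable_fun [set: T] X -> measurable_fun [set: T] G -> (forall w, 0 <= G w)%R ->
  \int[m]_w ((f (X w))%:E * (G w)%:E) =
  \sum_(r \in range f) (r%:E * \int[m]_(w in X @^-1` (f @^-1` [set r])) (G w)%:E).
Proof.
move=> mX mG G0.
have mI r : measurable (X @^-1` (f @^-1` [set r])).
  by rewrite -[X in measurable X]setTI; apply: mX => //; exact: measurable_funPTI.
have r0 r v : 0 <= (r * \1_(f @^-1` [set r]) v)%:E.
  exact: nnfun_muleindic_ge0.
have mi r : measurable_fun setT (fun w => (\1_(f @^-1` [set r]) (X w))%:E : \bar R).
  apply/measurable_EFinP.
  apply: (@measurableT_comp _ _ _ _ _ _ (\1_(f @^-1` [set r]) : V -> R) _ X) => //.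
transitivity (\int[m]_w (\sum_(r \in range f)
    ((r * \1_(f @^-1` [set r]) (X w))%:E * (G w)%:E))).
  apply: eq_integral => w _; rewrite fimfunE -fsumEFin//.
  by rewrite ge0_mule_fsuml.
rewrite ge0_integral_fsum//; first last.
- by move=> r w _; apply: mule_ge0; [exact: r0|rewrite lee_fin].
- move=> r; apply: emeasurable_funM => //; last exact/measurable_EFinP.
  under eq_fun do rewrite EFinM.
  exact: measurable_funeM.
apply: eq_fsbigr => r /[!inE] -[v _ fv].
have r_ge0 : (0 <= r)%R by rewrite -fv.
under eq_integral do rewrite EFinM -muleA.
rewrite ge0_integralZl//; last 2 first.
- by apply: emeasurable_funM => //; exact/measurable_EFinP.
- by move=> w _; rewrite mule_ge0// lee_fin.
congr (_ * _); rewrite [RHS]integral_mkcond; apply: eq_integral => w _.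
rewrite patchE indicE.
have -> : (X w \in f @^-1` [set r]) = (w \in X @^-1` (f @^-1` [set r])).
  by apply/idP/idP; rewrite !inE.
by case: ifP; rewrite ?mul1e ?mul0e.
Qed.

(** Monotone approximation by simple functions reduces the identity to the
    assumption on preimages.  Both the product rule for independent copies and
    the disintegration of an expectation by a conditional density are
    instances. *)
Lemma ge0_integral_transfer d1 (T1 : measurableType d1)
    d2 (T2 : measurableType d2)
    (m1 : {measure set T1 -> \bar R}) (m2 : {measure set T2 -> \bar R})
    (X1 : T1 -> V) (X2 : T2 -> V) (G1 : T1 -> R) (G2 : T2 -> R)
    (k : V -> \bar R) :
  measurable_fun [set: T1] X1 -> measurable_fun [set: T2] X2 ->
  measurable_fun [set: T1] G1 -> measurable_fun [set: T2] G2 ->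
  (forall w, 0 <= G1 w)%R -> (forall w, 0 <= G2 w)%R ->
  (forall A, measurable A -> \int[m1]_(w in X1 @^-1` A) (G1 w)%:E =
                             \int[m2]_(w in X2 @^-1` A) (G2 w)%:E) ->
  measurable_fun [set: V] k -> (forall v, 0 <= k v) ->
  \int[m1]_w (k (X1 w) * (G1 w)%:E) = \int[m2]_w (k (X2 w) * (G2 w)%:E).
Proof.
move=> mX1 mX2 mG1 mG2 G10 G20 G12 mk k0.
pose f := nnsfun_approx measurableT mk.
have lim d0 (T : measurableType d0) (m : {measure set T -> \bar R})
    (X : T -> V) (G : T -> R) : measurable_fun [set: T] X ->
    measurable_fun [set: T] G -> (forall w, 0 <= G w)%R ->
  \int[m]_w (k (X w) * (G w)%:E) = limn (fun n => \int[m]_w ((f n (X w))%:E * (G w)%:E)).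
  move=> mX mG G0; rewrite -monotone_convergence//.
  - apply: eq_integral => w _; apply/esym/cvg_lim => //.
    apply: cvgeZr => //.
    exact: (cvg_nnsfun_approx measurableT mk (fun v _ => k0 v)).
  - move=> n; apply: emeasurable_funM => //; last exact/measurable_EFinP.
    by apply/measurable_EFinP; exact: measurableT_comp.
  - by move=> n w _; rewrite mule_ge0// lee_fin.
  - move=> w _ a b ab; apply: lee_wpmul2r; first by rewrite lee_fin.
    rewrite lee_fin; have /lefP := nd_nnsfun_approx measurableT mk ab; exact.
rewrite !lim//; congr (limn _); apply/funext => n.
rewrite !integral_nnsfun_weight//; apply: eq_fsbigr => r _.
by rewrite G12//; exact: measurable_funPTI.
Qed.

Lemma integral_transfer d1 (T1 : measurableType d1)
    d2 (T2 : measurableType d2)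
    (m1 : {measure set T1 -> \bar R}) (m2 : {measure set T2 -> \bar R})
    (X1 : T1 -> V) (X2 : T2 -> V) (G1 : T1 -> R) (G2 : T2 -> R)
    (k : V -> \bar R) :
  measurable_fun [set: T1] X1 -> measurable_fun [set: T2] X2 ->
  measurable_fun [set: T1] G1 -> measurable_fun [set: T2] G2 ->
  (forall w, 0 <= G1 w)%R -> (forall w, 0 <= G2 w)%R ->
  (forall A, measurable A -> \int[m1]_(w in X1 @^-1` A) (G1 w)%:E =
                             \int[m2]_(w in X2 @^-1` A) (G2 w)%:E) ->
  measurable_fun [set: V] k ->
  \int[m1]_w (k (X1 w) * (G1 w)%:E) = \int[m2]_w (k (X2 w) * (G2 w)%:E).
Proof.
move=> mX1 mX2 mG1 mG2 G10 G20 G12 mk; rewrite (integralE m1) (integralE m2).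
have P d0 (T : measurableType d0) (X : T -> V) (G : T -> R) :
    (forall w, 0 <= G w)%R ->
    (fun w => k (X w) * (G w)%:E)^\+ = (fun w => k^\+ (X w) * (G w)%:E).
  move=> G0; apply/funext => w; rewrite !funeposE muleC [RHS]muleC.
  by rewrite maxeMr ?mule0 ?lee_fin.
have Q d0 (T : measurableType d0) (X : T -> V) (G : T -> R) :
    (forall w, 0 <= G w)%R ->
    (fun w => k (X w) * (G w)%:E)^\- = (fun w => k^\- (X w) * (G w)%:E).
  move=> G0; apply/funext => w; rewrite !funenegE -mulNe muleC [RHS]muleC.
  by rewrite maxeMr ?mule0 ?lee_fin.
rewrite !P// !Q//; congr (_ - _).
  by apply: ge0_integral_transfer => //; exact: measurable_funepos.
by apply: ge0_integral_transfer => //; exact: measurable_funeneg.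
Qed.

End Transfer.

(** * Exponential moments of sums of independent copies *)

Lemma measurable_expR_comp d (T : measurableType d) (R : realType) (f : T -> R) :
  measurable_fun [set: T] f -> measurable_fun [set: T] (fun x => expR (f x)).
Proof. by move=> mf; exact: (measurableT_comp (@measurable_expR R)). Qed.

Section IidProducts.
Context d (T : measurableType d) (R : realType) (P : probability T R).
Context d' (V : measurableType d') (n : nat).
Variables (Z : T -> V) (Zs : 'I_n -> T -> V).
Hypothesis mZ : measurable_fun [set: T] Z.
Hypothesis mZs : forall i, measurable_fun [set: T] (Zs i).
Hypothesis iid : iid_copies P Z Zs.

Lemma prod_indic (S : Type) (A : 'I_n -> set S) (v : 'I_n -> S) :
  \prod_i \1_(A i) (v i) = (`[< forall i, A i (v i) >])%:R :> R.
Proof.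
case: asboolP => [all|/existsNP[i0 nA]].
  by rewrite big1// => i _; rewrite indicE mem_set.
by rewrite (bigD1 i0)//= indicE memNset// mul0r.
Qed.

(** The factors of index at least [k] are still indicators, and the induction
    on [k] frees one factor at a time.  Independence is the case [k = 0]; in
    the inductive step the product of the other factors is the weight in
    [integral_transfer], so that only an indicator of the freed copy has to be
    considered, which is the induction hypothesis. *)
Lemma iid_expectation_prod_indic (k : nat) (chi : 'I_n -> V -> R) :
  (forall i, measurable_fun [set: V] (chi i)) ->
  (forall i v, 0 <= chi i v) ->
  (forall i, P.-integrable [set: T] (fun w => (chi i (Z w))%:E)) ->
  (forall i : 'I_n, (k <= i)%N -> exists2 A, measurable A & chi i = \1_A) ->
  (\int[P]_w (\prod_i chi i (Zs i w))%:E =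
   (\prod_i \int[P]_w chi i (Z w))%:E)%E.
Proof.
have mpre (X : T -> V) A : measurable_fun [set: T] X -> measurable A ->
    measurable (X @^-1` A).
  by move=> mX mA; rewrite -[X in measurable X]setTI; exact: mX.
have indZ (X : T -> V) A : measurable_fun [set: T] X -> measurable A ->
    (\int[P]_w (\1_A (X w))%:E)%E = P (X @^-1` A).
  move=> mX mA; rewrite -[X in _ = P X]setIT -integral_indic//; last exact: mpre.
elim: k chi => [|k IH] chi mchi chi0 ichi chiE.
  have /(_ _)/cid2-/all_sig2[A mA chiA] := fun i => chiE i (leq0n i).
  transitivity (P (\bigcap_i (Zs i @^-1` A i))).
    rewrite -[X in P X]setIT -integral_indic//; last first.
      by apply: fin_bigcap_measurable => // i _; exact: mpre.
    apply: eq_integral => w _; congr EFin; rewrite indicE.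
    under eq_bigr do rewrite chiA.
    rewrite prod_indic; congr (nat_of_bool _)%:R.
    apply/idP/idP => [/asboolP h|]; first by rewrite inE => i _; exact: h.
    by rewrite inE => h; apply/asboolP => i; exact: h.
  rewrite iid.2// -prodEFin; apply: eq_bigr => i _.
  rewrite iid.1// -indZ// /Rintegral chiA fineK//.
  by rewrite indZ// fin_num_measure//; exact: mpre.
have [nk|kn] := leqP n k.
  by apply: IH => // i ki; have := leq_ltn_trans ki (ltn_ord i); rewrite ltnNge nk.
pose i0 := Ordinal kn.
under eq_integral do rewrite (bigD1 i0)//= EFinM.
pose c := \prod_(i < n | i != i0) \int[P]_w chi i (Z w).
have c0 : 0 <= c by apply: prodr_ge0 => i _; exact: Rintegral_ge0.
rewrite (@integral_transfer _ _ R _ T _ T P P (Zs i0) Z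
  (fun w => \prod_(i < n | i != i0) chi i (Zs i w)) (cst c)
  (fun v => (chi i0 v)%:E)) => [|||||||A mA|]; rewrite -/c //.
- under eq_integral do rewrite muleC.
  rewrite integralZl// (bigD1 i0)//= -/c mulrC EFinM; congr (_ * _)%E.
  by rewrite /Rintegral fineK//; exact: integrable_fin_num.
- rewrite (_ : (fun w => _) =
      (fun w => \prod_(i < n) if i != i0 then chi i (Zs i w) else 1)); last first.
    by apply/funext => w; rewrite big_mkcond.
  apply: measurable_prod => i _; case: (i != i0) => //.
  exact: measurableT_comp.
- by move=> w; apply: prodr_ge0.
- have := IH (fun i => if i == i0 then \1_A else chi i) _ _ _ _.
  rewrite (bigD1 i0)//= eqxx (eq_bigr (fun i => \int[P]_w chi i (Z w))); last first.
    by move=> i /negPf ->.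
  rewrite -/c integral_cst//; last exact: mpre.
  rewrite /Rintegral indZ// mulrC EFinM fineK; last first.
    by rewrite fin_num_measure//; exact: mpre.
  move=> <-.
  + rewrite integral_mkcond; apply: eq_integral => w _; rewrite patchE.
    rewrite [in RHS](bigD1 i0)//= eqxx.
    rewrite [in RHS](eq_bigr (fun i => chi i (Zs i w))); last first.
      by move=> i /negPf ->.
    rewrite indicE.
    have -> : (w \in Zs i0 @^-1` A) = (Zs i0 w \in A).
      by apply/idP/idP; rewrite !inE.
    by case: (Zs i0 w \in A); rewrite ?mul1r ?mul0r.
  + by move=> i; case: ifP.
  + by move=> i v; case: ifP.
  + move=> i; case: ifP => // _.
    rewrite (_ : (fun w => _) = EFin \o \1_(Z @^-1` A)); last first.
      exact/funext.
    by apply: integrable_indic => //; exact: mpre.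
  + move=> i ki; case: eqP => [_|ii0]; first by exists A.
    apply: chiE; rewrite ltn_neqAle ki andbT; apply/eqP => kE; apply: ii0.
    by apply/val_inj; rewrite /= -kE.
- exact/measurable_EFinP.
Qed.

Lemma iid_expectation_prod (chi : 'I_n -> V -> R) :
  (forall i, measurable_fun [set: V] (chi i)) ->
  (forall i v, 0 <= chi i v) ->
  (forall i, P.-integrable [set: T] (fun w => (chi i (Z w))%:E)) ->
  (\int[P]_w (\prod_i chi i (Zs i w))%:E =
   (\prod_i \int[P]_w chi i (Z w))%:E)%E.
Proof.
move=> mchi chi0 ichi; apply: (iid_expectation_prod_indic (k := n)) => // i.
by rewrite leqNgt ltn_ord.
Qed.

Lemma iid_chernoff (phi : V -> R) (l a c : R) :
  measurable_fun [set: V] phi -> 0 < l ->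
  P.-integrable [set: T] (fun w => (expR (l * phi (Z w)))%:E) ->
  \int[P]_w expR (l * phi (Z w)) <= expR c ->
  (P [set w | a <= \sum_i phi (Zs i w)]%R <= (expR (n%:R * c - l * a))%:E)%E.
Proof.
move=> mphi l0 iphi mgf.
pose S w := \sum_i phi (Zs i w).
have mS : measurable_fun [set: T] S.
  by apply: measurable_sum => i; exact: measurableT_comp.
have mA : measurable [set w | a <= S w].
  have -> : [set w | a <= S w] = S @^-1` `[a, +oo[.
    by apply/seteqP; split => w /=; rewrite in_itv/= andbT.
  by rewrite -[X in measurable X]setTI; exact: mS.
have mprod : measurable_fun [set: T] (fun w => \prod_i expR (l * phi (Zs i w))).
  apply: measurable_prod => i _.
  apply: measurable_expR_comp.
  by apply: measurable_funM => //; exact: measurableT_comp.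
rewrite -[X in (P X <= _)%E]setIT -(integral_indic _ measurableT)//.
apply: (@le_trans _ _ (\int[P]_w ((expR (- (l * a)))%:E *
    (\prod_i expR (l * phi (Zs i w)))%:E))%E).
  apply: ge0_le_integral => //.
  - exact/measurable_EFinP.
  - by apply/measurable_EFinP; exact: measurable_funM.
  - move=> w _; rewrite -EFinM lee_fin indicE -expR_sum -expRD.
    case: (boolP (w \in _)) => [/set_mem/= aS|_]; last exact: expR_ge0.
    by rewrite -[leLHS]expR0 ler_expR -mulr_sumr addrC subr_ge0 ler_pM2l.
rewrite ge0_integralZl//; last 2 first.
- exact/measurable_EFinP.
- by move=> w _; rewrite lee_fin prodr_ge0// => i _; exact: expR_ge0.
rewrite (iid_expectation_prod (chi := fun _ v => expR (l * phi v))).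
- rewrite -EFinM lee_fin addrC expRD ler_pM2l ?expR_gt0//.
  rewrite prodr_const card_ord expRM_natl.
  by apply: lerXn2r => //; rewrite ?nnegrE ?expR_ge0 ?Rintegral_ge0// => w _; rewrite expR_ge0.
- by move=> i; apply: measurable_expR_comp; exact: measurable_funM.
- by move=> i v; exact: expR_ge0.
- by move=> i.
Qed.

End IidProducts.

(** * Sub-exponential variables *)

Section ExpBounds.
Context {R : realType}.
Implicit Types y z : R.

Lemma exp_ge_pow n y : 0 <= y -> (y / n.+1%:R) ^+ n.+1 <= expR y.
Proof.
move=> y0; rewrite -[y in leRHS](@divfK _ n.+1%:R)// [_ * n.+1%:R]mulrC expRM_natl.
apply: lerXn2r; rewrite ?nnegrE ?divr_ge0// ?expR_ge0//.
by apply: le_trans (expR_ge1Dx _); rewrite lerDr.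
Qed.

(** A second-order expansion with a generous constant, so that it follows from
    [1 + z <= expR z] alone: for [z <= 1/2] from that inequality at [- z], and
    for larger [z] because [1 <= 4 * z ^+ 2]. *)
Lemma exp_le_quadratic z : expR z <= 1 + z + 4 * z ^+ 2 * expR `|z|.
Proof.
have [z12|z12] := leP z (1 / 2).
  have h : expR z <= 1 + z + 2 * z ^+ 2.
    have := expR_ge1Dx (- z); rewrite expRN => h.
    have e0 := expR_gt0 z.
    have z1 : 0 < 1 - z by lra.
    have : expR z * (1 - z) <= 1.
      by rewrite -[leRHS](mulfV (lt0r_neq0 e0)) ler_pM2l.
    move=> h1; rewrite -(ler_pM2r z1); apply: (le_trans h1).
    have -> : (1 + z + 2 * z ^+ 2) * (1 - z) = 1 + z ^+ 2 * (1 - 2 * z) by ring.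
    by rewrite lerDl mulr_ge0 ?sqr_ge0//; lra.
  have e1 : 1 <= expR `|z| by rewrite -[leLHS]expR0 ler_expR.
  apply: (le_trans h); rewrite lerD2l.
  have := mulr_ge0 (sqr_ge0 z) (_ : 0 <= expR `|z| - 1).
  have := sqr_ge0 z; rewrite subr_ge0 => z2 /(_ e1); lra.
rewrite [`|z|]gtr0_norm; last by lra.
have e0 := expR_gt0 z.
suff : 1 * expR z <= 4 * z ^+ 2 * expR z by lra.
by rewrite ler_pM2r//; nra.
Qed.

End ExpBounds.

Section SubexponentialVariable.
Context d (T : measurableType d) (R : realType) (P : probability T R).
Variables (v : T -> R) (v0 : R).
Hypothesis mv : measurable_fun [set: T] v.
Hypothesis v0_gt0 : 0 < v0.
Hypothesis tail : forall s, 0 <= s ->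
  (P [set w | (v0 * s <= `|v w|)%R] <= (2 * expR (- s))%:E)%E.

Let e34 : 2 <= expR (3 / 4) :> R.
Proof.
have -> : 3 / 4 = 6%:R * (1 / 8) :> R by field.
rewrite expRM_natl; have := expR_ge1Dx (1 / 8 : R) => h.
apply: (@le_trans _ _ ((1 + 1 / 8) ^+ 6)); first by lra.
by apply: lerXn2r => //; rewrite nnegrE; [lra|exact: expR_ge0].
Qed.

Let e14 : expR (1 / 4) <= 4 / 3 :> R.
Proof.
have := expR_ge1Dx (- (1 / 4) : R); rewrite expRN => h.
have e0 := expR_gt0 (1 / 4 : R).
rewrite -(invrK (expR _)) -[leRHS]invrK lef_pV2 ?posrE ?invr_gt0//; lra.
Qed.

(** Slice along the integer part [k] of [`|v w| / v0]: the integrand is at most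
    [expR ((k + 1) / 4)] on a slice of probability at most [2 * expR (- k)].
    As [2 <= expR (3 / 4)], the resulting series is dominated by a geometric
    one of ratio [1/2]. *)
Lemma subexp_mgf : (\int[P]_w (expR (`|v w| / (4 * v0)))%:E <= 6%:E)%E.
Proof.
have mS k : measurable [set w | (v0 * k <= `|v w|)%R].
  have -> : [set w | (v0 * k <= `|v w|)%R] = (fun w => `|v w|) @^-1` `[v0 * k, +oo[.
    by apply/seteqP; split => w /=; rewrite in_itv/= andbT.
  have mn : measurable_fun [set: T] (fun w => `|v w|) by exact: measurableT_comp.
  by rewrite -[X in measurable X]setTI; exact: mn.
pose f (k : nat) w : \bar R :=
  (expR ((k%:R + 1) / 4) * \1_[set w | (v0 * k%:R <= `|v w|)%R] w)%:E.
have mf k : measurable_fun [set: T] (f k).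
  by apply/measurable_EFinP; apply: measurable_funM => //.
have f0 k w : (0 <= f k w)%E by rewrite lee_fin; apply: mulr_ge0; [exact: expR_ge0|rewrite indicE].
apply: (@le_trans _ _ (\int[P]_w (\sum_(k <oo) f k w))%E).
  apply: ge0_le_integral => //.
  - apply/measurable_EFinP; apply: measurable_expR_comp.
    by apply: measurable_funM => //; exact: measurableT_comp.
  - by apply: (ge0_emeasurable_sum (P := xpredT)).
  move=> w _; pose k := Num.truncn (`|v w| / v0).
  have kv : v0 * k%:R <= `|v w|.
    by rewrite mulrC -ler_pdivlMr// truncn_le divr_ge0// ltW.
  have vk : `|v w| / (4 * v0) <= (k%:R + 1) / 4.
    have -> : `|v w| / (4 * v0) = `|v w| / v0 / 4.
      by field; rewrite gt_eqF.
    by rewrite ler_pM2r ?invr_gt0// natr1 ltW// truncnS_gt.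
  apply: (@le_trans _ _ (f k w)).
    by rewrite lee_fin indicE mem_set//= mulr1 ler_expR.
  rewrite (nneseries_split 0 k.+1)//.
  rewrite add0n big_nat_recr//= addeC addeA leeDr// adde_ge0//.
    by apply: nneseries_ge0 => j _ _; exact: f0.
  by apply: sume_ge0 => j _; exact: f0.
rewrite integral_nneseries//.
apply: (@le_trans _ _ (\sum_(k <oo) ((16 / 3) / (2 ^ k.+1)%:R)%:E)%E).
  apply: lee_nneseries => [k _ _|k _].
    by apply: integral_ge0 => w _; exact: f0.
  rewrite /f; under eq_integral do rewrite EFinM.
  rewrite ge0_integralZl//; last first.
    by apply/measurable_EFinP.
  rewrite integral_indic// setIT.
  apply: (@le_trans _ _ ((expR ((k%:R + 1) / 4))%:E * (2 * expR (- k%:R))%:E)%E).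
    by apply: lee_wpmul2l; [rewrite lee_fin expR_ge0|exact: tail].
  rewrite -EFinM lee_fin.
  have -> : (k%:R + 1) / 4 = 1 / 4 + k%:R * (1 / 4) :> R by field.
  have -> : - k%:R = - (k%:R * (1 / 4)) - k%:R * (3 / 4) :> R by field.
  rewrite !expRD !expRN [expR (k%:R * (3 / 4))]expRM_natl.
  have -> : expR (1 / 4) * expR (k%:R * (1 / 4)) *
      (2 * ((expR (k%:R * (1 / 4)))^-1 * (expR (3 / 4) ^+ k)^-1)) =
      2 * expR (1 / 4) * (expR (3 / 4) ^+ k)^-1 :> R.
    by field; rewrite expf_neq0 ?gt_eqF ?expR_gt0.
  rewrite natrX exprS invfM; set z := 2 ^- k.
  have zle : (expR (3 / 4) ^+ k)^-1 <= z.
    rewrite lef_pV2 ?posrE ?exprn_gt0 ?expR_gt0//.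
    by apply: lerXn2r; rewrite ?nnegrE// expR_ge0.
  have z0 : 0 <= z by rewrite invr_ge0 exprn_ge0.
  have y0 : 0 <= (expR (3 / 4) ^+ k)^-1 :> R by rewrite invr_ge0 exprn_ge0// expR_ge0.
  move: e14 (expR_ge0 (1 / 4 : R)) zle z0 y0; nra.
apply: le_trans (epsilon_trick0 xpredT _) _; first lra.
by rewrite lee_fin; lra.
Qed.

Let weight w := expR (`|v w| / (4 * v0)).

Let mweight : measurable_fun [set: T] weight.
Proof.
apply: measurable_expR_comp; apply: measurable_funM => //.
exact: measurableT_comp.
Qed.

Let iweight : P.-integrable [set: T] (EFin \o weight).
Proof.
apply/integrableP; split; first exact/measurable_EFinP.
under eq_integral do rewrite /= ger0_norm ?expR_ge0//.
by apply: le_lt_trans subexp_mgf _; rewrite ltry.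
Qed.

Let weight_le : \int[P]_w weight w <= 6.
Proof.
rewrite -lee_fin /Rintegral fineK; first exact: subexp_mgf.
exact: integrable_fin_num iweight.
Qed.

Let int_of_weight (f : T -> R) c : measurable_fun [set: T] f ->
  (forall w, `|f w| <= c * weight w) -> P.-integrable [set: T] (EFin \o f).
Proof.
move=> mf fc; apply: (@le_integrable _ _ _ P _ _ _ (fun w => (c * weight w)%:E)) => //.
- exact/measurable_EFinP.
- by move=> w _; rewrite /= lee_fin (le_trans (fc w))// ler_norm.
- by under eq_fun do rewrite EFinM; exact: integrableZl.
Qed.

Let v_weight n w : `|v w| ^+ n.+1 <= (4 * v0 * n.+1%:R) ^+ n.+1 * weight w.
Proof.
have y0 : 0 <= `|v w| / (4 * v0) by rewrite divr_ge0// mulr_ge0// ltW.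
have -> : `|v w| ^+ n.+1 = (4 * v0 * n.+1%:R) ^+ n.+1 *
    (`|v w| / (4 * v0) / n.+1%:R) ^+ n.+1.
  rewrite -exprMn; congr (_ ^+ _); field.
  by rewrite nat1r pnatr_eq0 /= gt_eqF.
rewrite ler_pM2l; first exact: exp_ge_pow.
by rewrite exprn_gt0// !mulr_gt0.
Qed.

Lemma subexp_integrable_pow n : P.-integrable [set: T] (fun w => (`|v w| ^+ n.+1)%:E).
Proof.
apply: (int_of_weight (c := (4 * v0 * n.+1%:R) ^+ n.+1)).
  by apply: measurable_funX; exact: measurableT_comp.
by move=> w; rewrite ger0_norm ?exprn_ge0// v_weight.
Qed.

Lemma subexp_moment n :
  \int[P]_w (`|v w| ^+ n.+1) <= 6 * (4 * v0 * n.+1%:R) ^+ n.+1.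
Proof.
have c0 : 0 <= (4 * v0 * n.+1%:R) ^+ n.+1.
  by rewrite exprn_ge0// !mulr_ge0// ltW.
apply: (@le_trans _ _ (\int[P]_w ((4 * v0 * n.+1%:R) ^+ n.+1 * weight w))).
  apply: le_Rintegral => //.
  - exact: subexp_integrable_pow.
  - by rewrite /comp; under eq_fun do rewrite EFinM; exact: integrableZl.
by rewrite RintegralZl// mulrC ler_wpM2r.
Qed.

Lemma subexp_integrable (psi : T -> R) a : measurable_fun [set: T] psi ->
  (forall w, `|psi w| <= a * `|v w|) -> P.-integrable [set: T] (EFin \o psi).
Proof.
move=> mpsi psia; apply: (@le_integrable _ _ _ P _ _ _ (fun w => (a * `|v w| ^+ 1)%:E)) => //.
- exact/measurable_EFinP.
- by move=> w _; rewrite /= lee_fin (le_trans (psia w))// ler_norm.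
- under eq_fun do rewrite EFinM; apply: integrableZl => //.
  exact: subexp_integrable_pow.
Qed.

(** In the expansion of [expR (- l * psi)] the linear term has mean
    [- l * \int psi] and cancels the centring, so the exponent is quadratic in
    [l * a * v0].  The bound on [8 * (l * a * v0)] is what lets the quadratic
    remainder be absorbed: with [y := `|v| / (8 * v0)] the remainder is of order
    [y ^+ 2 * expR y], while [weight] equals [expR y ^+ 2]. *)
Lemma subexp_centered_mgf (psi : T -> R) (a l : R) :
  measurable_fun [set: T] psi -> (forall w, `|psi w| <= a * `|v w|) ->
  0 <= a -> 0 <= l -> 8 * (l * a * v0) <= 1 ->
  P.-integrable [set: T] (fun w => (expR (l * (\int[P]_z psi z - psi w)))%:E) /\
  \int[P]_w expR (l * (\int[P]_z psi z - psi w)) <=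
    expR (6 * (32 * (l * a * v0)) ^+ 2).
Proof.
move=> mpsi psia a0 l0 lav; set m := \int[P]_z psi z.
have ipsi := subexp_integrable mpsi psia.
have lav0 : 0 <= l * a * v0 by rewrite !mulr_ge0// ltW.
pose q w := 1 + - l * psi w + (32 * (l * a * v0)) ^+ 2 * weight w.
have half w : expR (- l * psi w) <= q w.
  apply: le_trans (exp_le_quadratic _) _; rewrite lerD2l.
  set y := `|v w| / (8 * v0).
  have y0 : 0 <= y by rewrite divr_ge0// mulr_ge0// ltW.
  have vy : `|v w| = 8 * v0 * y.
    by rewrite /y mulrCA mulfV ?mulr1// mulf_neq0// gt_eqF.
  have zy : `|- l * psi w| <= l * a * v0 * 8 * y.
    rewrite normrM normrN (ger0_norm l0).
    apply: le_trans (ler_wpM2l l0 (psia w)) _; rewrite vy.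
    by rewrite le_eqVlt; apply/orP; left; apply/eqP; ring.
  have zy1 : `|- l * psi w| <= y.
    apply: le_trans zy _; rewrite -[leRHS]mul1r ler_wpM2r//.
    by rewrite mulrC.
  have wy : weight w = expR y * expR y.
    by rewrite -expRD /weight; congr expR; rewrite vy; field; rewrite gt_eqF.
  have ey : y ^+ 2 <= 4 * expR y.
    have := exp_ge_pow 1 y0; rewrite expr_div_n ler_pdivrMr//; lra.
  rewrite -[X in 4 * X * _]real_normK ?num_real// wy.
  apply: (@le_trans _ _ (4 * (l * a * v0 * 8 * y) ^+ 2 * expR y)).
    apply: ler_pM.
    - by rewrite mulr_ge0 ?sqr_ge0.
    - exact: expR_ge0.
    - rewrite ler_pM2l//; apply: lerXn2r => //; rewrite nnegrE.
      by apply: mulr_ge0 => //; exact: mulr_ge0.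
    - by rewrite ler_expR.
  have -> : 4 * (l * a * v0 * 8 * y) ^+ 2 * expR y =
    (16 * (l * a * v0)) ^+ 2 * expR y * y ^+ 2 by ring.
  have -> : (32 * (l * a * v0)) ^+ 2 * (expR y * expR y) =
    (16 * (l * a * v0)) ^+ 2 * expR y * (4 * expR y) by ring.
  apply: ler_wpM2l => //; apply: mulr_ge0; last exact: expR_ge0.
  by rewrite sqr_ge0.
have ilp : P.-integrable [set: T] (EFin \o (fun w => - l * psi w)).
  by rewrite /comp; under eq_fun do rewrite EFinM; exact: integrableZl.
have iww : P.-integrable [set: T]
    (EFin \o (fun w => (32 * (l * a * v0)) ^+ 2 * weight w)).
  by rewrite /comp; under eq_fun do rewrite EFinM; exact: integrableZl.
have i1 : P.-integrable [set: T] (EFin \o (fun=> 1 : R)).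
  exact: finite_measure_integrable_cst.
have i1p : P.-integrable [set: T] (EFin \o (fun w => 1 + - l * psi w)).
  by rewrite /comp; under eq_fun do rewrite EFinD; exact: integrableD.
have iq : P.-integrable [set: T] (EFin \o q).
  by rewrite /comp; under eq_fun do rewrite /q EFinD; exact: integrableD.
have me : measurable_fun [set: T] (fun w => expR (- l * psi w)).
  by apply: measurable_expR_comp; exact: measurable_funM.
have ie : P.-integrable [set: T] (EFin \o (fun w => expR (- l * psi w))).
  apply: (@le_integrable _ _ _ P _ _ _ (EFin \o q)) => //.
  - exact/measurable_EFinP.
  - by move=> w _; rewrite /= lee_fin ger0_norm ?expR_ge0// (le_trans (half w))// ler_norm.
have eE w : expR (l * (m - psi w)) = expR (l * m) * expR (- l * psi w).
  by rewrite -expRD; congr expR; ring.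
split.
  by under eq_fun do rewrite eE EFinM; exact: integrableZl.
under eq_Rintegral do rewrite eE.
rewrite RintegralZl//.
have qE : \int[P]_w q w = 1 - l * m + (32 * (l * a * v0)) ^+ 2 * \int[P]_w weight w.
  rewrite /q RintegralD// RintegralD// !RintegralZl// Rintegral_cst//.
  have -> : fine (P [set: T]) = 1.
    by rewrite -[RHS]/(fine 1%E); congr fine; exact: probability_setT.
  by rewrite mulr1 mulNr.
apply: (@le_trans _ _ (expR (l * m) * expR (- (l * m) + 6 * (32 * (l * a * v0)) ^+ 2))).
  rewrite ler_pM2l ?expR_gt0//.
  apply: le_trans (le_Rintegral _ ie iq _) _ => //.
  apply: le_trans (expR_ge1Dx _); rewrite qE.
  have := weight_le; have := sqr_ge0 (32 * (l * a * v0)); nra.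
by rewrite -expRD addrA subrr add0r.
Qed.

End SubexponentialVariable.

(** * Deviation of one empirical mean *)

(** The factor [6 * 32 ^+ 2] is the one in [subexp_centered_mgf]; the additional
    unit pays for the exponent [- s] of [iid_deviation]. *)
Definition dev_cst {R : realType} : R := 1 + 6 * 32 ^+ 2.

(** Bernstein's rate: a sub-Gaussian part, and a sub-exponential part that takes
    over when [s] exceeds the order of [n]. *)
Definition dev_rate {R : realType} (n : nat) (s : R) : R :=
  dev_cst * Num.sqrt (s / n%:R) + 8 * (s / n%:R).

Section IidDeviation.
Context d (T : measurableType d) (R : realType) (P : probability T R).
Context d' (V : measurableType d') (n : nat).
Variables (Z : T -> V) (Zs : 'I_n -> T -> V).
Hypothesis mZ : measurable_fun [set: T] Z.
Hypothesis mZs : forall i, measurable_fun [set: T] (Zs i).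
Hypothesis iid : iid_copies P Z Zs.

Lemma iid_deviation (psi xi : V -> R) (a v0 s : R) : (0 < n)%N ->
  measurable_fun [set: V] psi -> measurable_fun [set: V] xi ->
  0 < a -> 0 < v0 -> 0 <= s ->
  (forall z, `|psi z| <= a * `|xi z|) ->
  (forall u, 0 <= u ->
    (P [set w | (v0 * u <= `|xi (Z w)|)%R] <= (2 * expR (- u))%:E)%E) ->
  (P [set w | (n%:R * (a * v0 * dev_rate n s) <=
               \sum_i (\int[P]_z psi (Z z) - psi (Zs i w)))%R]
   <= (expR (- s))%:E)%E.
Proof.
move=> n0 mpsi mxi a0 v00 s0 psia tail.
have nR : 0 < n%:R :> R by rewrite ltr0n.
have [->|sn0] := eqVneq s 0.
  rewrite oppr0 expR0; apply: probability_le1.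
  have mS : measurable_fun [set: T]
      (fun w => \sum_i (\int[P]_z psi (Z z) - psi (Zs i w))).
    apply: measurable_sum => i; apply: measurable_funB => //.
    exact: measurableT_comp.
  have -> : forall c, [set w | c <= \sum_i (\int[P]_z psi (Z z) - psi (Zs i w))] =
      (fun w => \sum_i (\int[P]_z psi (Z z) - psi (Zs i w))) @^-1` `[c, +oo[.
    by move=> c; apply/seteqP; split => w /=; rewrite in_itv/= andbT.
  by rewrite -[X in measurable X]setTI; exact: mS.
have {sn0}s0 : 0 < s by rewrite lt_def sn0.
set q := Num.sqrt (s / n%:R).
have q0 : 0 < q by rewrite sqrtr_gt0 divr_gt0.
have q2 : q ^+ 2 = s / n%:R by rewrite sqr_sqrtr// divr_ge0// ltW.
(* [mu] plays the role of [l * a * v0]: the optimal choice is [q], capped where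
   the bound on the moment generating function ceases to hold. *)
pose mu := Num.min (1 / 8) q.
have mu0 : 0 < mu by rewrite lt_min q0 andbT; lra.
pose l := mu / (a * v0).
have l0 : 0 < l by rewrite divr_gt0// mulr_gt0.
have lav : l * a * v0 = mu by rewrite /l -mulrA divfK// gt_eqF// mulr_gt0.
have [||| i mgf] := @subexp_centered_mgf _ _ _ P (xi \o Z) v0 _ v00 tail
  (psi \o Z) a l _ (fun w => psia (Z w)) (ltW a0) (ltW l0) _.
- exact: measurableT_comp.
- exact: measurableT_comp.
- rewrite lav; have : mu <= 1 / 8 by rewrite ge_min lexx.
  lra.
apply: le_trans (@iid_chernoff _ _ _ _ _ _ _ _ _ mZ mZs iid
  (fun z => \int[P]_z psi (Z z) - psi z) l _ (6 * (32 * (l * a * v0)) ^+ 2) _ l0 _ _) _ => //.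
  exact: measurable_funB.
rewrite lee_fin ler_expR lav.
have -> : l * (n%:R * (a * v0 * dev_rate n s)) = n%:R * (mu * dev_rate n s).
  by rewrite -lav; ring.
rewrite -mulrBr -[leRHS](@divfK _ n%:R) ?gt_eqF// [leRHS]mulrC ler_pM2l//.
rewrite mulNr -q2 /dev_rate -/q -q2 /dev_cst /mu.
have [q8|q8] := leP (1 / 8) q; nra.
Qed.

End IidDeviation.

(** * Euclidean vectors and nested dyadic rounding *)

Section EuclideanVectors.
Context {R : realType} {p : nat}.
Implicit Types (u v x : 'cV[R]_p) (c : R).

Lemma dotC u v : dot u v = dot v u.
Proof. by apply: eq_bigr => i _; rewrite mulrC. Qed.

Lemma dotDl u v x : dot (u + v) x = dot u x + dot v x.
Proof. by rewrite -big_split; apply: eq_bigr => i _ /=; rewrite mxE mulrDl. Qed.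

Lemma dotZl c u x : dot (c *: u) x = c * dot u x.
Proof. by rewrite [RHS]big_distrr; apply: eq_bigr => i _ /=; rewrite mxE mulrA. Qed.

Lemma dotNl u x : dot (- u) x = - dot u x.
Proof. by rewrite -scaleN1r dotZl mulN1r. Qed.

Lemma dotBl u v x : dot (u - v) x = dot u x - dot v x.
Proof. by rewrite dotDl dotNl. Qed.

Lemma dot0l x : dot 0 x = 0.
Proof. by rewrite -(scale0r (0 : 'cV_p)) dotZl mul0r. Qed.

Lemma dotDr x u v : dot x (u + v) = dot x u + dot x v.
Proof. by rewrite dotC dotDl !(dotC x). Qed.

Lemma dotZr c x u : dot x (c *: u) = c * dot x u.
Proof. by rewrite dotC dotZl dotC. Qed.

Lemma dotBr x u v : dot x (u - v) = dot x u - dot x v.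
Proof. by rewrite dotC dotBl !(dotC x). Qed.

Lemma dot_mulmx (A : 'M[R]_p) u v : dot u (A *m v) = dot (A^T *m u) v.
Proof.
rewrite /dot; under eq_bigr do rewrite mxE big_distrr /=.
rewrite exchange_big; apply: eq_bigr => j _; rewrite mxE big_distrl /=.
by apply: eq_bigr => i _; rewrite mxE; ring.
Qed.

Lemma dot_ge0 u : 0 <= dot u u.
Proof. by apply: sumr_ge0 => i _; rewrite -expr2 sqr_ge0. Qed.

Lemma norm2_ge0 u : 0 <= norm2 u.
Proof. exact: sqrtr_ge0. Qed.

Lemma norm2_sqr u : norm2 u ^+ 2 = dot u u.
Proof. by rewrite sqr_sqrtr// dot_ge0. Qed.

Lemma norm2Z c u : norm2 (c *: u) = `|c| * norm2 u.
Proof. by rewrite /norm2 dotZl dotZr mulrA -expr2 sqrtrM ?sqr_ge0// sqrtr_sqr. Qed.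

Lemma norm2_eq0 u : norm2 u = 0 -> u = 0.
Proof.
move=> u0; have : dot u u = 0 by rewrite -norm2_sqr u0 expr0n.
move/eqP; rewrite psumr_eq0; last by move=> i _; rewrite -expr2 sqr_ge0.
move=> /allP h; apply/matrixP => i j; rewrite mxE (ord1 j).
by have /eqP := h i (mem_index_enum i); move/eqP; rewrite mulf_eq0 orbb => /eqP.
Qed.

Lemma norm2_unit_exists : (0 < p)%N -> exists e : 'cV[R]_p, norm2 e = 1.
Proof.
move=> p0; exists (delta_mx (Ordinal p0) 0).
rewrite /norm2 /dot (bigD1 (Ordinal p0))//= !mxE !eqxx mulr1 big1 ?addr0 ?sqrtr1//.
by move=> i /negPf i0; rewrite mxE i0 mul0r.
Qed.

Lemma unit_direction u : (0 < p)%N ->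
  exists2 e, norm2 e = 1 & u = norm2 u *: e.
Proof.
move=> p0; have [u0|u0] := eqVneq (norm2 u) 0.
  have [e e1] := norm2_unit_exists p0; exists e => //.
  by rewrite u0 scale0r; exact: norm2_eq0.
exists ((norm2 u)^-1 *: u); last by rewrite scalerA mulfV// scale1r.
by rewrite norm2Z ger0_norm ?invr_ge0 ?norm2_ge0// mulVf.
Qed.

(** The weighted arithmetic-geometric inequality [key] is optimized over its
    weight [c]. *)
Lemma cauchy_schwarz u v : `|dot u v| <= norm2 u * norm2 v.
Proof.
have key c x y : 0 < c -> `|dot x y| <= (c * dot x x + c^-1 * dot y y) / 2.
  move=> c0; rewrite ler_norml; apply/andP; split.
    rewrite -subr_ge0.
    have := mulr_ge0 (ltW c0) (dot_ge0 (x + c^-1 *: y)).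
    rewrite !dotDl !dotDr !dotZl !dotZr (dotC y x).
    have -> : c * (dot x x + c^-1 * dot x y + (c^-1 * dot x y + c^-1 * (c^-1 * dot y y))) =
      c * dot x x + c^-1 * dot y y + 2 * dot x y by field; rewrite gt_eqF.
    lra.
  rewrite -subr_ge0.
  have := mulr_ge0 (ltW c0) (dot_ge0 (x - c^-1 *: y)).
  rewrite !dotBl !dotBr !dotZl !dotZr (dotC y x).
  have -> : c * (dot x x - c^-1 * dot x y - (c^-1 * dot x y - c^-1 * (c^-1 * dot y y))) =
    c * dot x x + c^-1 * dot y y - 2 * dot x y by field; rewrite gt_eqF.
  lra.
have [u0|u0] := eqVneq (norm2 u) 0.
  by rewrite (norm2_eq0 u0) dot0l normr0 mulr_ge0// norm2_ge0.
have [v0|v0] := eqVneq (norm2 v) 0.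
  by rewrite (norm2_eq0 v0) dotC dot0l normr0 mulr_ge0// norm2_ge0.
have ug : 0 < norm2 u by rewrite lt_def u0 norm2_ge0.
have vg : 0 < norm2 v by rewrite lt_def v0 norm2_ge0.
have := key (norm2 v / norm2 u) u v (divr_gt0 vg ug).
rewrite -!norm2_sqr => /le_trans; apply; rewrite le_eqVlt; apply/orP; left.
by apply/eqP; field; rewrite u0 v0.
Qed.

Lemma norm2_le_coord c u : 0 <= c -> (forall i, `|u i 0| <= c) ->
  norm2 u <= c * Num.sqrt p%:R.
Proof.
move=> c0 uc; rewrite -[c]ger0_norm// -sqrtr_sqr -sqrtrM ?sqr_ge0//.
rewrite ler_wsqrtr// /dot; apply: (@le_trans _ _ (\sum_(i < p) c ^+ 2)).
  apply: ler_sum => i _; rewrite -expr2 -real_normK ?num_real//.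
  by apply: lerXn2r; rewrite ?nnegrE.
by rewrite sumr_const card_ord mulr_natr.
Qed.

End EuclideanVectors.

Section DyadicRounding.
Context {R : realType} {p : nat}.
Implicit Types (v : 'cV[R]_p) (k : nat).

Lemma truncn_double_half (y : R) : 0 <= y -> (Num.truncn (2 * y))./2 = Num.truncn y.
Proof.
move=> y0; apply/esym/truncn_def; set a := Num.truncn (2 * y).
have a1 : a%:R <= 2 * y by rewrite truncn_le mulr_ge0.
have a2 : 2 * y < a.+1%:R := truncnS_gt _.
have aE : a%:R = (odd a)%:R + 2 * (a./2)%:R :> R.
  by rewrite -[in LHS](odd_double_half a) natrD -mul2n natrM.
move: a2; rewrite -!natr1 aE => a2; move: a1; rewrite aE => a1.
have o0 : 0 <= (odd a)%:R :> R by [].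
have o1 : (odd a)%:R <= 1 :> R by case: (odd a).
apply/andP; split; lra.
Qed.

(** Rounding each coordinate at this step displaces a vector by at most
    [2^-1 ^+ k] in Euclidean norm. *)
Definition mesh k : R := (2 ^+ k * Num.sqrt p%:R)^-1.

Definition grid_point k (z : 'I_p -> bool * nat) : 'cV[R]_p :=
  \col_i ((-1) ^+ (z i).1 * (z i).2%:R * mesh k).

(** Rounding magnitudes towards zero at steps that halve makes the levels nested:
    the code of a vector at level [k] is that at level [k.+1] with every
    magnitude halved ([grid_parent_code]).  The link from a point of the chain to
    its predecessor is thus a function of a single code, and a union bound over
    the codes of each level covers all links. *)
Definition grid_parent k (z : 'I_p -> bool * nat) : 'cV[R]_p :=
  if k is k'.+1 then grid_point k' (fun i => ((z i).1, (z i).2./2)) else 0.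

Definition grid_code k v (i : 'I_p) : bool * nat :=
  (v i 0 < 0, Num.truncn (`|v i 0| / mesh k)).

Hypothesis p0 : (0 < p)%N.

Lemma mesh_gt0 k : 0 < mesh k.
Proof. by rewrite invr_gt0 mulr_gt0 ?exprn_gt0// sqrtr_gt0 ltr0n. Qed.

Lemma mesh_sqrt k : mesh k * Num.sqrt p%:R = 2^-1 ^+ k.
Proof.
rewrite /mesh invfM -mulrA mulVf ?mulr1 ?exprVn//.
by rewrite gt_eqF// sqrtr_gt0 ltr0n.
Qed.

Lemma grid_parent_code k v :
  grid_parent k.+1 (grid_code k.+1 v) = grid_point k (grid_code k v).
Proof.
apply/matrixP => i j; rewrite !mxE /=; congr (_ * _%:R * _).
rewrite -[RHS]truncn_double_half; last by rewrite divr_ge0// ltW// mesh_gt0.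
by congr (Num.truncn _)./2; rewrite /mesh !invrK exprS; ring.
Qed.

Lemma grid_code_approx k v : norm2 (v - grid_point k (grid_code k v)) <= 2^-1 ^+ k.
Proof.
rewrite -mesh_sqrt; apply: norm2_le_coord => [|i]; first exact/ltW/mesh_gt0.
rewrite !mxE /=; have m0 := mesh_gt0 k.
set y := v i 0; set a := (Num.truncn _)%:R.
have a1 : a * mesh k <= `|y|.
  by rewrite -ler_pdivlMr// truncn_le divr_ge0// ltW.
have a2 : `|y| < a * mesh k + mesh k.
  by rewrite -[X in _ + X]mul1r -mulrDl -ltr_pdivrMr// natr1 truncnS_gt.
rewrite ler_norml; case: (ltP y 0) a1 a2 => y0.
  by rewrite expr1 ltr0_norm// => a1 a2; apply/andP; split; lra.
by rewrite expr0 ger0_norm// => a1 a2; apply/andP; split; lra.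
Qed.

Lemma norm2_grid_code k v : norm2 (grid_point k (grid_code k v)) <= norm2 v.
Proof.
rewrite ler_wsqrtr//; apply: ler_sum => i _; rewrite -!expr2 -real_normK ?num_real//.
rewrite -[leRHS]real_normK ?num_real//; apply: lerXn2r; rewrite ?nnegrE//.
rewrite mxE !normrM normrX normrN1 expr1n mul1r normr_nat gtr0_norm ?mesh_gt0//=.
by rewrite -ler_pdivlMr ?mesh_gt0// truncn_le divr_ge0// ltW// mesh_gt0.
Qed.

Lemma grid_step k v : norm2 v = 1 ->
  norm2 (grid_point k (grid_code k v) - grid_parent k (grid_code k v)) <= 2^-1 ^+ k.
Proof.
case: k => [|k] v1; first by rewrite subr0 expr0 -v1 norm2_grid_code.
rewrite -mesh_sqrt; apply: norm2_le_coord => [|i]; first exact/ltW/mesh_gt0.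
rewrite !mxE /=; set a := Num.truncn _.
have m0 := mesh_gt0 k.+1.
have -> : mesh k = 2 * mesh k.+1.
  by rewrite /mesh exprS -mulrA [in RHS]invfM mulrA mulfV ?mul1r.
have -> : a%:R = (odd a)%:R + 2 * (a./2)%:R :> R.
  by rewrite -[in LHS](odd_double_half a) natrD -mul2n natrM.
set sg := (-1) ^+ _; set o := (odd a)%:R; set b := (a./2)%:R.
have -> : sg * (o + 2 * b) * mesh k.+1 - sg * b * (2 * mesh k.+1) =
  sg * o * mesh k.+1 by ring.
rewrite !normrM normrX normrN1 expr1n mul1r (gtr0_norm m0) /o.
by case: (odd a); rewrite ?normr1 ?mul1r// normr0 mul0r ltW.
Qed.

(** The coordinates of a unit vector have sum at most [Num.sqrt p%:R] in absolute
    value, here from [a <= (1 + a ^+ 2) / 2] at [a := Num.sqrt p * `|v i 0|].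
    Large magnitudes are therefore rare in a code, and the magnitudes contribute
    only [p] to [code_cost], at every level. *)
Lemma grid_code_weight k v : norm2 v = 1 ->
  \sum_i ((grid_code k v i).2%:R / 2 ^+ k) <= p%:R :> R.
Proof.
move=> v1; have p0R : 0 < p%:R :> R by rewrite ltr0n.
apply: (@le_trans _ _ (\sum_(i < p) (1 + p%:R * v i 0 ^+ 2) / 2)).
  apply: ler_sum => i _ /=; rewrite ler_pdivrMr ?exprn_gt0//.
  apply: (@le_trans _ _ (`|v i 0| / mesh k)).
    by rewrite truncn_le divr_ge0// ltW// mesh_gt0.
  rewrite /mesh invrK mulrCA [leRHS]mulrC ler_pM2l ?exprn_gt0//.
  rewrite -[v i 0 ^+ 2]real_normK ?num_real//.
  have := sqr_ge0 (Num.sqrt p%:R * `|v i 0| - 1).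
  have := sqr_sqrtr (ltW p0R); set q := Num.sqrt _; set y := `|v i 0| => <-.
  nra.
rewrite -big_distrl /= big_split /= -big_distrr /= sumr_const card_ord.
have -> : \sum_(i < p) v i 0 ^+ 2 = 1.
  by rewrite -[RHS](expr1n _ 2) -v1 norm2_sqr; apply: eq_bigr => i _; rewrite expr2.
lra.
Qed.

Lemma grid_code_bound k v i : norm2 v = 1 ->
  ((grid_code k v i).2 <= 2 ^ k * p)%N.
Proof.
move=> v1; rewrite -(ler_nat R) natrM natrX /=.
apply: (@le_trans _ _ (`|v i 0| / mesh k)).
  by rewrite truncn_le divr_ge0// ltW// mesh_gt0.
have vi : `|v i 0| <= 1.
  rewrite -v1 -sqrtr_sqr ler_wsqrtr// /dot (bigD1 i)//= expr2 lerDl.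
  by apply: sumr_ge0 => j _; rewrite -expr2 sqr_ge0.
have p1 : 1 <= p%:R :> R by rewrite ler1n.
have sp : Num.sqrt p%:R <= p%:R :> R.
  rewrite -[leRHS]ger0_norm// -sqrtr_sqr ler_wsqrtr//.
  by rewrite expr2 ler_peMr.
rewrite /mesh invrK mulrCA ler_pM2l ?exprn_gt0//.
by apply: le_trans sp; rewrite ler_piMl.
Qed.

End DyadicRounding.

(** * Weights on the rounded vectors *)

Section GridCodes.
Context {R : realType}.
Variables (p k : nat).

(** Magnitudes are capped at the bound of [grid_code_bound], which turns the
    codes of unit vectors into a finite type. *)
Definition grid_code_type := {ffun 'I_p -> bool * 'I_(2 ^ k * p).+1}.

Definition code_of (z : grid_code_type) (i : 'I_p) : bool * nat :=
  ((z i).1, val (z i).2).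

(** A code length in the sense of Kraft's inequality ([sum_code_cost]): one share
    for the level, and for each coordinate an amount growing with its magnitude,
    so that points far from the unit sphere are expensive.  It serves as the
    additional exponent granted to each link in the union bound. *)
Definition code_cost (z : grid_code_type) : R :=
  k.+1%:R + \sum_i ((code_of z i).2%:R / 2 ^+ k + (2 + k%:R)).

Lemma exp_nat_ge_pow2 (m : nat) : 2 ^+ m <= expR m%:R :> R.
Proof.
rewrite -[m%:R]mulr1 expRM_natl; apply: lerXn2r; rewrite ?nnegrE ?expR_ge0//.
by apply: le_trans (expR_ge1Dx _); lra.
Qed.

Lemma sum_geometric_le (x : R) m : 0 < x ->
  \sum_(j < m) expR (- (j%:R * x)) <= (1 + x) / x.
Proof.
move=> x0; set q := expR (- x).
have q0 : 0 < q by exact: expR_gt0.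
have qx : q * (1 + x) <= 1.
  rewrite /q -[leRHS](mulVf (lt0r_neq0 (expR_gt0 x))) expRN ler_pM2l ?invr_gt0 ?expR_gt0//.
  exact: expR_ge1Dx.
have q1 : 0 < 1 - q by nra.
have -> : \sum_(j < m) expR (- (j%:R * x)) = \sum_(j < m) q ^+ j.
  by apply: eq_bigr => j _; rewrite -mulrN expRM_natl.
have h : (1 - q) * \sum_(j < m) q ^+ j <= 1.
  rewrite -opprB mulNr -subrX1 opprB gerBl.
  by rewrite exprn_ge0// ltW.
rewrite ler_pdivlMr//.
have S0 : 0 <= \sum_(j < m) q ^+ j by apply: sumr_ge0 => j _; rewrite exprn_ge0// ltW.
move: S0 h; set S := \sum_(_ < _) _ => S0 h.
nra.
Qed.

(** The sum factors over the coordinates.  Each factor is at most one: the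
    magnitudes sum to at most [1 + 2 ^ k], there are two signs, and
    [expR (- (2 + k))] is at most [2 ^- k.+2]. *)
Lemma sum_code_cost : \sum_z expR (- code_cost z) <= (2 ^ k.+1)%:R^-1.
Proof.
pose F (c : bool * 'I_(2 ^ k * p).+1) : R :=
  expR (- (c.2%:R / 2 ^+ k + (2 + k%:R))).
rewrite (eq_bigr (fun z : grid_code_type => expR (- k.+1%:R) * \prod_i F (z i))); last first.
  by move=> z _; rewrite /F -expR_sum -expRD sumrN -opprD.
rewrite -big_distrr /= -(bigA_distr_bigA (fun=> F)) prodr_const card_ord.
have F1 : \sum_c F c <= 1.
  rewrite -(pair_big xpredT xpredT (fun b j => F (b, j)))/= big_bool /F /=.
  pose x : R := 2^-1 ^+ k.
  have x0 : 0 < x by rewrite exprn_gt0.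
  have xk : x = (2 ^+ k)^-1 by rewrite /x exprVn.
  have x1 : x <= 1 by rewrite exprn_ile1//; lra.
  pose m := (2 ^ k * p).+1.
  have -> : \sum_(j < m) expR (- (j%:R / 2 ^+ k + (2 + k%:R))) =
      expR (- k.+2%:R) * \sum_(j < m) expR (- (j%:R * x)).
    rewrite big_distrr /=; apply: eq_bigr => j _; rewrite -expRD xk.
    by congr expR; rewrite -!natr1; ring.
  have S := sum_geometric_le m x0.
  have E : expR (- k.+2%:R) <= x / 4.
    have -> : x / 4 = (2 ^+ k.+2)^-1 by rewrite xk !exprS; field; rewrite expf_neq0.
    by rewrite expRN lef_pV2 ?posrE ?expR_gt0 ?exprn_gt0// exp_nat_ge_pow2.
  have SE : expR (- k.+2%:R) * \sum_(j < m) expR (- (j%:R * x)) <= x / 4 * ((1 + x) / x).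
    by apply: ler_pM => //; apply: sumr_ge0 => j _; exact: expR_ge0.
  have : x / 4 * ((1 + x) / x) = (1 + x) / 4 by field; rewrite gt_eqF.
  lra.
rewrite natrX expRN -[leRHS]mulr1; apply: ler_pM.
- by rewrite invr_ge0 expR_ge0.
- by rewrite exprn_ge0// sumr_ge0// => c _; exact: expR_ge0.
- by rewrite lef_pV2 ?posrE ?expR_gt0 ?exprn_gt0// exp_nat_ge_pow2.
- by rewrite exprn_ile1// sumr_ge0// => c _; exact: expR_ge0.
Qed.

End GridCodes.

Section FiniteUnion.
Context d (T : measurableType d) (R : realType) (P : {measure set T -> \bar R}).

Lemma bigsetU_subadditive (I : finType) (B : I -> set T) (b : I -> R) :
  (forall i, measurable (B i)) -> (forall i, (P (B i) <= (b i)%:E)%E) ->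
  measurable (\big[setU/set0]_i B i) /\
  (P (\big[setU/set0]_i B i) <= (\sum_i b i)%:E)%E.
Proof.
move=> mB Bb; elim/big_rec2 : _ => [|i s A _ [mA As]].
  by split; [exact: measurable0|rewrite measure0].
split; first exact: measurableU.
apply: le_trans (measureU2 _ _ _) _ => //.
rewrite EFinD; apply: leeD; [exact: Bb|exact: As].
Qed.

End FiniteUnion.

(** * Uniform deviation over a sphere by chaining *)

Section DevRate.
Context {R : realType}.

(** When [(p + t) / n] is at most one, the sub-exponential part of the rate is
    dominated by the sub-Gaussian part. *)
Lemma dev_rate_le (n k p : nat) (t s : R) : (0 < n)%N -> 0 < t ->
  (p%:R + t) / n%:R <= 1 -> 0 <= s -> s <= 4 * k.+1%:R * (p%:R + t) ->
  dev_rate n s <= k.+1%:R * ((2 * dev_cst + 32) * Num.sqrt ((p%:R + t) / n%:R)).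
Proof.
move=> n0 t0 pn1 s0 sle.
have nR : 0 < n%:R :> R by rewrite ltr0n.
have p0 : 0 <= p%:R :> R by [].
set q := Num.sqrt _.
have q0 : 0 <= q by exact: sqrtr_ge0.
have q2 : q ^+ 2 = (p%:R + t) / n%:R.
  by rewrite sqr_sqrtr// divr_ge0//; lra.
have q1 : q <= 1 by rewrite -sqrtr1 ler_wsqrtr.
have k1 : 1 <= k.+1%:R :> R by rewrite ler1n.
have snle : s / n%:R <= 4 * k.+1%:R * q ^+ 2.
  by rewrite q2 mulrA ler_pM2r ?invr_gt0.
have sq : Num.sqrt (s / n%:R) <= 2 * k.+1%:R * q.
  have -> : 2 * k.+1%:R * q = Num.sqrt ((2 * k.+1%:R * q) ^+ 2).
    by rewrite sqrtr_sqr ger0_norm// !mulr_ge0.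
  rewrite ler_wsqrtr//; apply: (le_trans snle).
  have -> : (2 * k.+1%:R * q) ^+ 2 = 4 * k.+1%:R * q ^+ 2 * k.+1%:R by ring.
  by rewrite ler_peMr// !mulr_ge0// sqr_ge0.
have qq : k.+1%:R * q ^+ 2 <= k.+1%:R * q.
  by rewrite ler_pM2l ?ltr0n// expr2 ler_piMl.
rewrite /dev_rate.
have A0 : 0 <= dev_cst :> R by rewrite /dev_cst; lra.
have := ler_wpM2l A0 sq; lra.
Qed.

(** The sum of the full series is 4. *)
Lemma sum_arith_geom_le k : \sum_(j < k) (j.+1%:R * 2^-1 ^+ j) <= 4 :> R.
Proof.
have -> : \sum_(j < k) (j.+1%:R * 2^-1 ^+ j) = 4 - 2 * (k%:R + 2) * 2^-1 ^+ k :> R.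
  elim: k => [|k IH]; first by rewrite big_ord0 expr0; lra.
  by rewrite big_ord_recr /= IH exprS -!natr1; field.
by rewrite gerBl !mulr_ge0// ?exprn_ge0// addr_ge0.
Qed.

Lemma le_geometric_limit (a b c : R) : 0 <= c ->
  (forall k, a <= b + c * 2^-1 ^+ k) -> a <= b.
Proof.
move=> c0 h; rewrite leNgt; apply/negP => ba.
have d0 : 0 < a - b by rewrite subr_gt0.
pose k := Num.truncn (c / (a - b)).
have ck : c < (a - b) * k.+1%:R.
  by rewrite mulrC -ltr_pdivrMr// truncnS_gt.
have k2 : k.+1%:R <= 2 ^+ k :> R by rewrite -natrX ler_nat ltn_expl.
have := h k; rewrite exprVn -lerBlDl -(ler_pM2r (_ : 0 < 2 ^+ k)) ?exprn_gt0//.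
rewrite mulfVK ?expf_neq0// => h2.
have : (a - b) * k.+1%:R <= (a - b) * 2 ^+ k by rewrite ler_pM2l.
lra.
Qed.

(** Here [K] is the level, [Q] the dimension and [S] the sum bounded in
    [grid_code_weight]: the exponent of a link at level [K] is of the order of
    [(K + 1) * (p + t)]. *)
Lemma code_cost_arith (t K Q S : R) : 0 <= t -> 0 <= K -> 1 <= Q -> S <= Q ->
  t + (K + 1 + (S + (2 + K) * Q)) <= 4 * (K + 1) * (Q + t).
Proof.
move=> t0 K0 Q1 SQ; have Kt : 0 <= K * t by rewrite mulr_ge0.
have KQ : 0 <= K * (Q - 1) by rewrite mulr_ge0// subr_ge0.
lra.
Qed.

End DevRate.

Section Chaining.
Context d (T : measurableType d) (R : realType) (P : probability T R).
Context d' (V : measurableType d') (n p : nat).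
Variables (Z : T -> V) (Zs : 'I_n -> T -> V).
Hypothesis mZ : measurable_fun [set: T] Z.
Hypothesis mZs : forall i, measurable_fun [set: T] (Zs i).
Hypothesis iid : iid_copies P Z Zs.
Variables (phi : V -> 'cV[R]_p) (g : 'cV[R]_p -> V -> R) (v0 r t : R).
Hypothesis mg : forall u, measurable_fun [set: V] (g u).
Hypothesis mphi : forall u, measurable_fun [set: V] (fun z => dot u (phi z)).
Hypothesis g0 : forall z, g 0 z = 0.
Hypothesis glip : forall u u' z, `|g u z - g u' z| <= `|dot (u - u') (phi z)|.
Hypothesis tail : forall u s, norm2 u = 1 -> 0 <= s ->
  (P [set w | (v0 * s <= `|dot u (phi (Z w))|)%R] <= (2 * expR (- s))%:E)%E.
Hypotheses (p0 : (0 < p)%N) (n0 : (0 < n)%N) (v00 : 0 < v0) (r0 : 0 < r) (t0 : 0 < t).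
Hypothesis small : (p%:R + t) / n%:R <= 1.

Let nR : 0 < n%:R :> R. Proof. by rewrite ltr0n. Qed.

Let glip_dir c u u' : norm2 (u - u') <= c ->
  exists2 e, norm2 e = 1 & forall z, `|g u z - g u' z| <= c * `|dot e (phi z)|.
Proof.
move=> uc; have [e e1 ue] := unit_direction (u - u') p0.
exists e => // y; apply: le_trans (glip _ _ _) _.
rewrite ue dotZl normrM ger0_norm ?norm2_ge0// ler_wpM2r//.
Qed.

Let idot e : norm2 e = 1 ->
  P.-integrable [set: T] (fun w => (`|dot e (phi (Z w))| ^+ 1)%:E).
Proof.
move=> e1; apply: (subexp_integrable_pow (v0 := v0)) => //.
  by apply: (measurableT_comp (mphi e)).
by move=> s; exact: tail.
Qed.

Let igdiff u u' : P.-integrable [set: T] (fun w => (g u (Z w) - g u' (Z w))%:E).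
Proof.
have [e e1 ge] := glip_dir (lexx (norm2 (u - u'))).
have mv : measurable_fun [set: T] (fun w => dot e (phi (Z w))).
  exact: (measurableT_comp (mphi e)).
apply: (subexp_integrable mv v00 (fun s => tail e1 (s := s)) _
  (fun w => ge (Z w))).
by apply: measurable_funB; exact: measurableT_comp.
Qed.

Let gdiff_mean u u' :
  \int[P]_z (g u (Z z) - g u' (Z z)) <= norm2 (u - u') * (24 * v0).
Proof.
have [e e1 ge] := glip_dir (lexx (norm2 (u - u'))).
apply: (@le_trans _ _ (\int[P]_w (norm2 (u - u') * `|dot e (phi (Z w))| ^+ 1))).
  apply: le_Rintegral => //; first exact: igdiff.
  - by rewrite /comp; under eq_fun do rewrite EFinM; apply: integrableZl => //; exact: idot.
  - by move=> w _; apply: le_trans (ler_norm _) _; exact: ge.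
rewrite RintegralZl//; last exact: idot.
rewrite ler_wpM2l ?norm2_ge0//.
have mv : measurable_fun [set: T] (fun w => dot e (phi (Z w))).
  exact: (measurableT_comp (mphi e)).
apply: le_trans (subexp_moment mv v00 (fun s => tail e1 (s := s)) 0) _.
rewrite expr1; lra.
Qed.

Let ig u : P.-integrable [set: T] (fun w => (g u (Z w))%:E).
Proof.
have := igdiff u 0; congr integrable; apply/funext => w.
by rewrite g0 subr0.
Qed.

Let X u w := \sum_i (\int[P]_z g u (Z z) - g u (Zs i w)).

Let XB u u' w : X u w - X u' w =
  \sum_i (\int[P]_z (g u (Z z) - g u' (Z z)) - (g u (Zs i w) - g u' (Zs i w))).
Proof.
rewrite -sumrB RintegralB//; try exact: ig.
by apply: eq_bigr => i _; ring.
Qed.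

Let mX u : measurable_fun [set: T] (X u).
Proof.
apply: measurable_sum => i; apply: measurable_funB => //.
exact: measurableT_comp.
Qed.

Let pt k (z : grid_code_type p k) := grid_point k (code_of z) : 'cV[R]_p.
Let pa k (z : grid_code_type p k) := grid_parent k (code_of z) : 'cV[R]_p.
Let cost k (z : grid_code_type p k) : R := t + code_cost z.

(** The event that the link of [z] deviates too much.  Links longer than those
    of unit vectors are discarded: the deviation bound does not control them. *)
Let bad k (z : grid_code_type p k) : set T :=
  if norm2 (pt z - pa z) <= 2^-1 ^+ k then
    [set w | n%:R * (r * 2^-1 ^+ k * v0 * dev_rate n (cost z)) <=
             X (r *: pt z) w - X (r *: pa z) w]
  else set0.

Let cost_ge0 k (z : grid_code_type p k) : 0 <= cost z.
Proof.
rewrite /cost /code_cost; apply: addr_ge0; first exact: ltW.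
apply: addr_ge0 => //; apply: sumr_ge0 => i _.
by apply: addr_ge0; rewrite ?addr_ge0// divr_ge0// exprn_ge0.
Qed.

Let bad_prob k (z : grid_code_type p k) :
  measurable (bad z) /\ (P (bad z) <= (expR (- cost z))%:E)%E.
Proof.
rewrite /bad; case: ifPn => [zk|_]; last first.
  by split; [exact: measurable0|rewrite measure0 lee_fin expR_ge0].
have rk : norm2 (r *: pt z - r *: pa z) <= r * 2^-1 ^+ k.
  by rewrite -scalerBr norm2Z gtr0_norm// ler_pM2l.
have [e e1 ge] := glip_dir rk.
split.
  have mXX : measurable_fun [set: T] (fun w => X (r *: pt z) w - X (r *: pa z) w).
    exact: measurable_funB.
  have -> : forall c, [set w | c <= X (r *: pt z) w - X (r *: pa z) w] =
      (fun w => X (r *: pt z) w - X (r *: pa z) w) @^-1` `[c, +oo[.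
    by move=> c; apply/seteqP; split => w /=; rewrite in_itv/= andbT.
  by rewrite -[X in measurable X]setTI; exact: mXX.
under eq_set do rewrite XB.
apply: (iid_deviation mZ mZs iid (psi := fun y => g (r *: pt z) y - g (r *: pa z) y)
  (xi := fun y => dot e (phi y))) => //.
- exact: measurable_funB.
- by rewrite mulr_gt0// exprn_gt0.
- by move=> u; exact: tail.
Qed.

Let Bad := \bigcup_k (\big[setU/set0]_(z : grid_code_type p k) bad z).

Let Bad_prob : measurable Bad /\ (P Bad <= (expR (- t))%:E)%E.
Proof.
have Bk k : measurable (\big[setU/set0]_(z : grid_code_type p k) bad z) /\
    (P (\big[setU/set0]_(z : grid_code_type p k) bad z) <=
      (expR (- t) / (2 ^ k.+1)%:R)%:E)%E.
  have [mB PB] := @bigsetU_subadditive _ _ _ P _ (@bad k)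
    (fun z => expR (- cost z)) (fun z => (bad_prob z).1) (fun z => (bad_prob z).2).
  split => //; apply: le_trans PB _; rewrite lee_fin.
  have -> : \sum_(z : grid_code_type p k) expR (- cost z) =
      expR (- t) * \sum_(z : grid_code_type p k) expR (- code_cost z).
    by rewrite [RHS]big_distrr /=; apply: eq_bigr => z _; rewrite -expRD /cost opprD.
  by rewrite ler_pM2l ?expR_gt0//; exact: sum_code_cost.
have mBad : measurable Bad by apply: bigcup_measurable => k _; exact: (Bk k).1.
split => //; apply: le_trans (generalized_Boole_inequality _ _ _) _ => //.
  by move=> k; exact: (Bk k).1.
apply: le_trans (epsilon_trick0 xpredT (expR_ge0 (- t))).
by apply: lee_nneseries => [k _ _|k _]; [exact: measure_ge0|exact: (Bk k).2].
Qed.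

Let code k (v : 'cV[R]_p) : grid_code_type p k :=
  [ffun i => ((grid_code k v i).1, inord (grid_code k v i).2)].

Let code_ofE k v : norm2 v = 1 -> code_of (code k v) = grid_code k v.
Proof.
move=> v1; apply/funext => i; rewrite /code_of ffunE /= inordK; last first.
  by rewrite ltnS grid_code_bound.
by rewrite [RHS]surjective_pairing.
Qed.

Let q := Num.sqrt ((p%:R + t) / n%:R).

Let good_step k (v : 'cV[R]_p) w : norm2 v = 1 -> ~ Bad w ->
  X (r *: grid_point k (grid_code k v)) w - X (r *: grid_parent k (grid_code k v)) w
  <= n%:R * (r * v0 * ((2 * dev_cst + 32) * q)) * (k.+1%:R * 2^-1 ^+ k).
Proof.
move=> v1 nB.
have : ~ bad (code k v) w.
  move=> bw; apply: nB; exists k => //.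
  by rewrite -bigcup_seq; exists (code k v) => //=; exact: mem_index_enum.
rewrite /bad /pt /pa code_ofE// grid_step//= => /negP; rewrite -ltNge => /ltW h.
apply: (le_trans h).
have -> : n%:R * (r * v0 * ((2 * dev_cst + 32) * q)) * (k.+1%:R * 2^-1 ^+ k) =
  n%:R * (r * 2^-1 ^+ k * v0 * (k.+1%:R * ((2 * dev_cst + 32) * q))) by ring.
rewrite ler_pM2l// ler_pM2l; last by rewrite !mulr_gt0// exprn_gt0.
apply: dev_rate_le => //.
rewrite /cost /code_cost code_ofE// big_split /= sumr_const card_ord -[_ *+ p]mulr_natr.
have h1 := grid_code_weight p0 k v1.
move: h1; set S := \sum_(_ < _) _; rewrite -natr1 => h1.
by apply: code_cost_arith => //; rewrite ?ler1n ?ltW.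
Qed.

Let good_level k (v : 'cV[R]_p) w : norm2 v = 1 -> ~ Bad w ->
  X (r *: grid_point k (grid_code k v)) w <= n%:R * (r * v0 * (4 * (2 * dev_cst + 32) * q)).
Proof.
move=> v1 nB.
have : X (r *: grid_point k (grid_code k v)) w <=
    n%:R * (r * v0 * ((2 * dev_cst + 32) * q)) * \sum_(j < k.+1) (j.+1%:R * 2^-1 ^+ j).
  elim: k => [|k IH].
    rewrite big_ord_recr big_ord0 /= add0r expr0.
    have := good_step 0 v1 nB; rewrite /= scaler0.
    have -> : X 0 w = 0.
      rewrite /X big1// => i _; rewrite g0 subr0.
      by under eq_Rintegral do rewrite g0; rewrite Rintegral_cst// mul0r.
    by rewrite subr0.
  rewrite big_ord_recr /= mulrDr.
  have := good_step k.+1 v1 nB; rewrite grid_parent_code// => h.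
  by rewrite -[leLHS](subrK (X (r *: grid_point k (grid_code k v)) w)) addrC; exact: lerD.
move=> /le_trans; apply.
have A0 : 0 <= 2 * dev_cst + 32 :> R by rewrite /dev_cst; lra.
have c0 : 0 <= n%:R * (r * v0 * ((2 * dev_cst + 32) * q)).
  apply: mulr_ge0 => //; apply: mulr_ge0; first by rewrite mulr_ge0// ltW.
  by apply: mulr_ge0 => //; exact: sqrtr_ge0.
have := ler_wpM2l c0 (sum_arith_geom_le (R := R) k.+1); lra.
Qed.

(** Write a point of the sphere as the telescoping sum of its roundings.  Outside
    the union of the events [bad], the link of level [k] contributes at most its
    length [r * 2^-1 ^+ k] times [k.+1] times the rate [q], and these sum to a
    multiple of [r * q] without logarithmic factors.  The remainder vanishes as
    the level grows, by the Lipschitz property of [g]. *)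
Lemma uniform_deviation : exists B : set T,
  [/\ measurable B, (P B <= (expR (- t))%:E)%E &
  forall w u, ~ B w -> norm2 u = r ->
    \int[P]_z g u (Z z) - 4 * (2 * dev_cst + 32) * r * v0 * q <=
    n%:R^-1 * \sum_i g u (Zs i w)].
Proof.
exists Bad; have [mB PB] := Bad_prob; split => // w u nB ur.
pose v := r^-1 *: u.
have v1 : norm2 v = 1.
  by rewrite norm2Z ur gtr0_norm ?invr_gt0// mulVf// gt_eqF.
have uv : u = r *: v by rewrite scalerA mulfV ?gt_eqF// scale1r.
suff : X u w <= n%:R * (r * v0 * (4 * (2 * dev_cst + 32) * q)).
  rewrite /X sumrB sumr_const card_ord -[X in X - _ <= _]mulr_natl => h.
  rewrite [leRHS]mulrC ler_pdivlMr// mulrBl.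
  lra.
(* [L] bounds the slope of the deviation for the sample at hand; 24 is the
   constant [6 * 4] of [subexp_moment] for the first moment. *)
pose L := \sum_i (24 * v0 + norm2 (phi (Zs i w))).
have L0 : 0 <= L.
  by apply: sumr_ge0 => i _; rewrite addr_ge0 ?norm2_ge0// mulr_ge0// ltW.
apply: (@le_geometric_limit _ _ _ (r * L)) => [|k]; first by rewrite mulr_ge0// ltW.
apply: le_trans (_ : X (r *: grid_point k (grid_code k v)) w + r * L * 2^-1 ^+ k <= _); last first.
  by rewrite lerD2r good_level.
rewrite -lerBlDl XB.
set u' := r *: grid_point _ _.
have duu' : norm2 (u - u') <= r * 2^-1 ^+ k.
  by rewrite uv -scalerBr norm2Z gtr0_norm// ler_pM2l// grid_code_approx.
apply: (@le_trans _ _ (norm2 (u - u') * L)); last first.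
  by rewrite mulrAC ler_wpM2r.
rewrite big_distrr /=; apply: ler_sum => i _; rewrite mulrDr; apply: lerD.
  exact: gdiff_mean.
apply: le_trans (ler_norm _) _; rewrite normrN.
by apply: le_trans (glip _ _ _) _; exact: cauchy_schwarz.
Qed.

End Chaining.

(** * The smoothed check loss *)

Section AffineSubstitution.
Context {R : realType}.
Notation mu := (@lebesgue_measure R).

(** Uniqueness of Lebesgue measure reduces the substitution to half-open
    intervals. *)
Lemma ge0_integral_affine (c h : R) (G : R -> \bar R) : 0 < h ->
  measurable_fun [set: R] G -> (forall v, 0 <= G v)%E ->
  (\int[mu]_v G v = h%:E * \int[mu]_s G (c + h * s)%R)%E.
Proof.
move=> h0 mG G0.
pose psi : measurableTypeR R -> measurableTypeR R := fun s => c + h * s.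
have mpsi : measurable_fun setT psi.
  by apply: measurable_funD => //; apply: measurable_funM.
pose nu : {measure set (measurableTypeR R) -> \bar R} :=
  measure_function_pushforward__canonical__measure_function_Measure mu mpsi.
pose m' := mscale (NngNum (ltW h0)) nu.
have m'E A : measurable A -> mu A = m' A.
  apply: lebesgue_measure_unique => _ [[a b]] _ <-.
  change (mu `]a, b]%classic = h%:E * mu (psi @^-1` `]a, b]%classic))%E.
  have -> : psi @^-1` `]a, b] = `](a - c) / h, (b - c) / h]%classic.
    apply/seteqP; split => s /=; rewrite !in_itv/= ltr_pdivrMr// ler_pdivlMr//;
      rewrite ltrBlDl lerBrDl (mulrC s); done.
  rewrite !lebesgue_measure_itv/= !lte_fin ltr_pM2r ?invr_gt0// ltrD2r.
  case: ifPn => _; last by rewrite mule0.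
  by rewrite -!EFinB -EFinM; congr EFin; field; rewrite gt_eqF.
rewrite (eq_measure_integral m')/=; last first.
  by move=> A mA _; rewrite m'E.
rewrite ge0_integral_mscale//=.
congr (_ * _)%E; rewrite ge0_integral_pushforward//.
Qed.

Lemma integral_opp (f : R -> R) : measurable_fun [set: R] f ->
  \int[mu]_s f (- s) = \int[mu]_s f s.
Proof.
move=> mf; rewrite /Rintegral; congr fine.
have mopp : measurable_fun setT (-%R : measurableTypeR R -> measurableTypeR R).
  exact: measurable_funN.
have ge0 (G : R -> \bar R) : measurable_fun [set: R] G -> (forall v, 0 <= G v)%E ->
    (\int[mu]_s G (- s)%R = \int[mu]_s G s)%E.
  move=> mG G0.
  pose nu : {measure set (measurableTypeR R) -> \bar R} :=
    measure_function_pushforward__canonical__measure_function_Measure mu mopp.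
  rewrite [RHS](eq_measure_integral nu)/=; last first.
    by move=> A mA _; rewrite -lebesgue_measureN.
  by rewrite ge0_integral_pushforward.
have mE : measurable_fun [set: R] (EFin \o f) by exact/measurable_EFinP.
rewrite (integralE mu _ (EFin \o f)) (integralE mu _ (fun s => (f (- s))%:E)).
rewrite -(ge0 (EFin \o f)^\+%E)//; last exact: measurable_funepos.
rewrite -(ge0 (EFin \o f)^\-%E)//; last exact: measurable_funeneg.
by congr (_ - _)%E; apply: eq_integral => s _; rewrite ?funeposE ?funenegE.
Qed.

End AffineSubstitution.

Section SmoothedLoss.
Context {R : realType}.
Notation mu := (@lebesgue_measure R).
Variables (tau h kappa1 kappa2 kappau : R) (K : R -> R).
Hypothesis tau01 : 0 < tau < 1.
Hypothesis h0 : 0 < h.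
Hypothesis HK : kernel_assumption K kappa1 kappa2 kappau.

(** A maximum of two linear forms with slopes in [[-1, 1]], which gives the
    Lipschitz and convexity bounds below. *)
Lemma check_loss_max u : check_loss tau u = Num.max (tau * u) ((tau - 1) * u).
Proof.
rewrite /check_loss; case: (ltP u 0) => u0 /=.
  rewrite max_r; first by rewrite mulrC.
  by rewrite mulrBl mul1r lerBrDr gerDl ltW.
rewrite subr0 max_l; first by rewrite mulrC.
by rewrite mulrBl mul1r gerBl.
Qed.

Lemma check_loss_ge0 u : 0 <= check_loss tau u.
Proof.
have /andP[t0 t1] := tau01; rewrite check_loss_max le_max.
have [u0|u0] := leP 0 u; apply/orP; [left|right].
  by rewrite mulr_ge0// ltW.
by apply: mulr_le0; [lra|exact: ltW].
Qed.

Lemma check_loss_lip u v : `|check_loss tau u - check_loss tau v| <= `|u - v|.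
Proof.
have /andP[t0 t1] := tau01.
have half x z : check_loss tau x - check_loss tau z <= `|x - z|.
  have b c : `|c| <= 1 -> c * x <= c * z + `|x - z|.
    move=> c1; rewrite -lerBlDl -mulrBr; apply: le_trans (ler_norm _) _.
    by rewrite normrM ler_piMl.
  have [b1 b2] : `|tau| <= 1 /\ `|tau - 1| <= 1.
    by split; rewrite ler_norml; apply/andP; split; lra.
  rewrite lerBlDr addrC !check_loss_max ge_max; apply/andP; split.
    by apply: le_trans (b _ b1) _; rewrite lerD2r le_max lexx.
  by apply: le_trans (b _ b2) _; rewrite lerD2r le_max lexx orbT.
by rewrite ler_norml lerNl opprB half distrC half.
Qed.

Lemma check_loss_convex s u v : 0 <= s <= 1 ->
  check_loss tau (s * u + (1 - s) * v) <=
  s * check_loss tau u + (1 - s) * check_loss tau v.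
Proof.
move=> /andP[s0 s1]; rewrite !check_loss_max ge_max.
have mU : tau * u <= Num.max (tau * u) ((tau - 1) * u) by rewrite le_max lexx.
have mU' : (tau - 1) * u <= Num.max (tau * u) ((tau - 1) * u) by rewrite le_max lexx orbT.
have mV : tau * v <= Num.max (tau * v) ((tau - 1) * v) by rewrite le_max lexx.
have mV' : (tau - 1) * v <= Num.max (tau * v) ((tau - 1) * v) by rewrite le_max lexx orbT.
move: mU mU' mV mV'; set U := Num.max _ _; set W := Num.max _ _ => mU mU' mV mV'.
apply/andP; split.
  have -> : tau * (s * u + (1 - s) * v) = s * (tau * u) + (1 - s) * (tau * v) by ring.
  by rewrite lerD// ler_wpM2l// subr_ge0.
have -> : (tau - 1) * (s * u + (1 - s) * v) =
  s * ((tau - 1) * u) + (1 - s) * ((tau - 1) * v) by ring.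
by rewrite lerD// ler_wpM2l// subr_ge0.
Qed.

Lemma lipschitz_measurable (f : R -> R) :
  (forall u v, `|f u - f v| <= `|u - v|) -> measurable_fun [set: R] f.
Proof.
move=> lf; apply: continuous_measurable_fun => x; apply/cvgrPdist_le => e e0.
have /cvgrPdist_le/(_ _ e0) := @cvg_id _ (nbhs x).
by apply: filterS => y; apply: le_trans.
Qed.

Lemma measurable_check_loss : measurable_fun [set: R] (check_loss tau).
Proof. by apply: lipschitz_measurable => u v; exact: check_loss_lip. Qed.

Let mK := kernel_measurable HK.
Let K0 := kernel_ge0 HK.

Let integrable_kernel_ge0 (f : R -> R) k : measurable_fun [set: R] f ->
  (forall s, 0 <= f s) -> (\int[mu]_s (f s)%:E = k%:E)%E ->
  mu.-integrable [set: R] (EFin \o f).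
Proof.
move=> mf f0 fk; apply/integrableP; split; first exact/measurable_EFinP.
under eq_integral do rewrite /= ger0_norm//.
by rewrite fk ltry.
Qed.

Lemma integrable_kernel : mu.-integrable [set: R] (EFin \o K).
Proof. exact: integrable_kernel_ge0 (kernel_int1 HK). Qed.

Lemma integrable_kernel1 : mu.-integrable [set: R] (EFin \o (fun s => `|s| * K s)).
Proof.
apply: (integrable_kernel_ge0 _ _ (kernel_kappa1 HK)).
  by apply: measurable_funM => //; exact: normr_measurable.
by move=> s; rewrite mulr_ge0.
Qed.

Lemma integrable_kernel2 : mu.-integrable [set: R] (EFin \o (fun s => `|s| ^+ 2 * K s)).
Proof.
apply: (integrable_kernel_ge0 _ _ (kernel_kappa2 HK)).
  apply: measurable_funM => //; apply: measurable_funX; exact: normr_measurable.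
by move=> s; rewrite mulr_ge0// exprn_ge0.
Qed.

Lemma integrable_kernel_growth (f : R -> R) a b c : measurable_fun [set: R] f ->
  (forall s, `|f s| <= a + b * `|s| + c * `|s| ^+ 2) ->
  mu.-integrable [set: R] (EFin \o (fun s => f s * K s)).
Proof.
move=> mf fa.
have iq : mu.-integrable [set: R]
    (EFin \o (fun s => a * K s + b * (`|s| * K s) + c * (`|s| ^+ 2 * K s))).
  have iZ k (g : R -> R) : mu.-integrable [set: R] (EFin \o g) ->
    mu.-integrable [set: R] (EFin \o (fun s => k * g s)).
    by move=> ig; rewrite /comp; under eq_fun do rewrite EFinM; exact: integrableZl.
  have iD (g g' : R -> R) : mu.-integrable [set: R] (EFin \o g) ->
    mu.-integrable [set: R] (EFin \o g') ->
    mu.-integrable [set: R] (EFin \o (fun s => g s + g' s)).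
    by move=> ig ig'; rewrite /comp; under eq_fun do rewrite EFinD; exact: integrableD.
  apply: (iD _ _ (iD _ _ (iZ _ _ _) (iZ _ _ _)) (iZ _ _ _)).
  - exact: integrable_kernel.
  - exact: integrable_kernel1.
  - exact: integrable_kernel2.
apply: (@le_integrable _ _ _ mu _ _ _ _ _ _ iq) => //.
  by apply/measurable_EFinP; exact: measurable_funM.
move=> s _; rewrite /= lee_fin normrM [`|K s|]ger0_norm//.
apply: le_trans (ler_norm _).
have -> : a * K s + b * (`|s| * K s) + c * (`|s| ^+ 2 * K s) =
  (a + b * `|s| + c * `|s| ^+ 2) * K s by ring.
by rewrite ler_wpM2r.
Qed.

Lemma kernel_integral1 : \int[mu]_s K s = 1.
Proof. by rewrite /Rintegral (kernel_int1 HK). Qed.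

Lemma kernel_integral2 : \int[mu]_s (`|s| ^+ 2 * K s) = kappa2.
Proof. by rewrite /Rintegral (kernel_kappa2 HK). Qed.

Lemma kernel_first_moment : \int[mu]_s (s * K s) = 0.
Proof.
have isK : mu.-integrable [set: R] (EFin \o (fun s => s * K s)).
  by apply: (integrable_kernel_growth (a := 0) (b := 1) (c := 0)) => // s; lra.
have : \int[mu]_s (s * K s) = - \int[mu]_s (s * K s).
  rewrite -[in LHS]integral_opp; last exact: measurable_funM.
  under eq_Rintegral do rewrite (kernel_sym HK) mulNr -mulN1r.
  by rewrite RintegralZl// mulN1r.
lra.
Qed.

(** After the substitution the kernel is free of [a], and the smoothed loss
    inherits the regularity of the check loss. *)
Lemma smoothed_lossE a :
  smoothed_loss tau K h a = \int[mu]_s (check_loss tau (a + h * s) * K s).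
Proof.
rewrite /smoothed_loss /Rintegral; congr fine.
have mc : measurable_fun [set: R] (fun s => check_loss tau (a + h * s)).
  apply: (measurableT_comp measurable_check_loss).
  by apply: measurable_funD => //; exact: measurable_funM.
rewrite (@ge0_integral_affine _ a h)//; last 2 first.
- apply/measurable_EFinP; apply: measurable_funM; first exact: measurable_check_loss.
  rewrite /scaled_kernel; apply: measurable_funM => //.
  apply: (measurableT_comp mK); apply: measurable_funM => //.
  exact: measurable_funB.
- move=> v; rewrite lee_fin mulr_ge0 ?check_loss_ge0// /scaled_kernel.
  by rewrite mulr_ge0// invr_ge0 ltW.
rewrite -ge0_integralZl//.
- apply: eq_integral => s _; rewrite -EFinM /scaled_kernel; congr EFin.
  rewrite (addrC a) addrK [h * s]mulrC mulfK ?gt_eqF//.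
  by field; rewrite gt_eqF.
- apply/measurable_EFinP; apply: measurable_funM => //.
  rewrite /scaled_kernel; apply: measurable_funM => //.
  apply: (measurableT_comp mK); apply: measurable_funM => //.
  by apply: measurable_funB => //; apply: measurable_funD.
- move=> v _; rewrite lee_fin mulr_ge0 ?check_loss_ge0// /scaled_kernel.
  by rewrite mulr_ge0// invr_ge0 ltW.
- by rewrite lee_fin ltW.
Qed.

Let msh c : measurable_fun [set: R] (fun s => check_loss tau (c + h * s)).
Proof.
apply: (measurableT_comp measurable_check_loss).
by apply: measurable_funD => //; exact: measurable_funM.
Qed.

Lemma integrable_smoothed a :
  mu.-integrable [set: R] (EFin \o (fun s => check_loss tau (a + h * s) * K s)).
Proof.
apply: (integrable_kernel_growth (a := `|a|) (b := h) (c := 0)) => // s.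
have c0 : check_loss tau 0 = 0 by rewrite /check_loss mul0r.
have := check_loss_lip (a + h * s) 0; rewrite c0 !subr0 => /le_trans; apply.
by rewrite mul0r addr0 (le_trans (ler_normD _ _))// normrM (gtr0_norm h0).
Qed.

Lemma smoothed_loss_diff a b :
  smoothed_loss tau K h a - smoothed_loss tau K h b =
  \int[mu]_s ((check_loss tau (a + h * s) - check_loss tau (b + h * s)) * K s).
Proof.
rewrite !smoothed_lossE -RintegralB//; try exact: integrable_smoothed.
by apply: eq_Rintegral => s _; rewrite mulrBl.
Qed.

Lemma smoothed_loss_lip a b :
  `|smoothed_loss tau K h a - smoothed_loss tau K h b| <= `|a - b|.
Proof.
have bd s : `|(check_loss tau (a + h * s) - check_loss tau (b + h * s)) * K s| <=
    `|a - b| * K s.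
  rewrite normrM [`|K s|]ger0_norm// ler_wpM2r//.
  apply: le_trans (check_loss_lip _ _) _.
  by rewrite opprD addrACA subrr addr0.
have id : mu.-integrable [set: R] (EFin \o (fun s =>
    (check_loss tau (a + h * s) - check_loss tau (b + h * s)) * K s)).
  rewrite (_ : EFin \o _ = (fun s => (check_loss tau (a + h * s) * K s)%:E -
      (check_loss tau (b + h * s) * K s)%:E)%E).
    by apply: integrableB => //; exact: integrable_smoothed.
  by apply/funext => s /=; rewrite mulrBl EFinB.
rewrite smoothed_loss_diff; apply: le_trans (le_normr_Rintegral _ id) _ => //.
apply: (@le_trans _ _ (\int[mu]_s (`|a - b| * K s))).
  apply: le_Rintegral => //.
  - exact: integrable_norm id.
  - rewrite /comp; under eq_fun do rewrite EFinM; apply: integrableZl => //.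
    exact: integrable_kernel.
by rewrite RintegralZl ?kernel_integral1 ?mulr1//; exact: integrable_kernel.
Qed.

Lemma measurable_smoothed_loss : measurable_fun [set: R] (smoothed_loss tau K h).
Proof. by apply: lipschitz_measurable => u v; exact: smoothed_loss_lip. Qed.

Lemma smoothed_loss_convex s a b : 0 <= s <= 1 ->
  smoothed_loss tau K h (s * a + (1 - s) * b) <=
  s * smoothed_loss tau K h a + (1 - s) * smoothed_loss tau K h b.
Proof.
move=> s01; rewrite !smoothed_lossE -!RintegralZl//; try exact: integrable_smoothed.
have iZ k c : mu.-integrable [set: R] (EFin \o (fun y => k * (check_loss tau (c + h * y) * K y))).
  rewrite /comp; under eq_fun do rewrite EFinM.
  by apply: integrableZl => //; exact: integrable_smoothed.
rewrite -RintegralD//; apply: le_Rintegral => //.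
- exact: integrable_smoothed.
- rewrite /comp; under eq_fun do rewrite EFinD.
  by apply: integrableD => //; exact: iZ.
move=> y _.
have -> : s * a + (1 - s) * b + h * y = s * (a + h * y) + (1 - s) * (b + h * y) by ring.
rewrite [s * (_ * _)]mulrA [(1 - s) * (_ * K y)]mulrA -mulrDl.
by apply: ler_wpM2r; [exact: K0|exact: check_loss_convex].
Qed.

End SmoothedLoss.

(** * The nonlinear part of a check-loss increment *)

Section Kink.
Context {R : realType}.
Notation mu := (@lebesgue_measure R).
Implicit Types c e a b M : R.

(** The remainder in Knight's identity [check_loss_kink]: a triangle on the
    interval between [0] and [c], zero elsewhere. *)
Definition kink c e : R :=
  if 0 < e then Num.max (c - e) 0 else Num.max (e - c) 0.

Lemma check_loss_kink (tau c e : R) :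
  check_loss tau (e - c) - check_loss tau e =
  c * ((e <= 0)%R%:R - tau) + kink c e.
Proof.
rewrite /check_loss /kink (leNgt e 0); case: (ltP 0 e) => e0 /=.
  have -> : (e < 0) = false by apply/negbTE; rewrite -leNgt ltW.
  case: (ltP (e - c) 0) => ec /=.
    by rewrite max_l; [ring|lra].
  by rewrite max_r; [ring|lra].
have [e0'|e0'] := ltP e 0.
  by case: (ltP (e - c) 0) => ec /=; ring.
have -> : e = 0 by lra.
by rewrite !sub0r; case: (ltP (- c) 0) => ec /=; ring.
Qed.

Lemma kink_lip a b e : `|kink b e - kink a e| <= `|b - a|.
Proof.
have maxlip (x y : R) : `|Num.max x 0 - Num.max y 0| <= `|x - y|.
  rewrite ler_norml; have := ler_norm (x - y); have := ler_norm (- (x - y)).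
  rewrite normrN => h1 h2; have := normr_ge0 (x - y) => h3.
  by case: (leP x 0) => x0; case: (leP y 0) => y0; apply/andP; split; lra.
rewrite /kink; case: ifP => _; apply: (le_trans (maxlip _ _)).
  by rewrite opprB addrA subrK.
by rewrite opprB addrC addrA subrK distrC.
Qed.

Lemma kink_out c e : `|c| < `|e| -> kink c e = 0.
Proof.
move=> ce; rewrite /kink; case: (ltP 0 e) ce => e0.
  by rewrite (gtr0_norm e0) => ce; apply: max_r; have := ler_norm c; lra.
by rewrite (ler0_norm e0) => ce; apply: max_r; have := ler_norm (- c); rewrite normrN; lra.
Qed.

Lemma kink_diff_le a b M e : `|a| <= M -> `|b| <= M ->
  `|kink b e - kink a e| <= `|b - a| * \1_(`[- M, M]) e.
Proof.
move=> aM bM; rewrite indicE mem_setE in_itv/= -ler_norml.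
case: (leP `|e| M) => eM /=; first by rewrite mulr1 kink_lip.
rewrite !kink_out ?subrr ?normr0 ?mulr0//.
- exact: le_lt_trans aM eM.
- exact: le_lt_trans bM eM.
Qed.

Lemma measurable_kink d (T : measurableType d) (c e : T -> R) :
  measurable_fun [set: T] c -> measurable_fun [set: T] e ->
  measurable_fun [set: T] (fun z => kink (c z) (e z)).
Proof.
move=> mc me; apply: measurable_fun_ifT.
- exact: measurable_fun_ltr.
- by apply: measurable_maxr => //; exact: measurable_funB.
- by apply: measurable_maxr => //; exact: measurable_funB.
Qed.

Let quad_derive (s c x : R) :
  is_derive x (1 : R) (fun y : R => s * (c * y - y ^+ 2 / 2)) (s * (c - x)).
Proof.
by apply: is_derive_eq; rewrite /GRing.scale /=; field.
Qed.

Let quad_FTC (s c a b : R) : a < b ->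
  (\int[mu]_(x in `[a, b]) (s * (c - x))%:E =
   (s * (c * b - b ^+ 2 / 2))%:E - (s * (c * a - a ^+ 2 / 2))%:E)%E.
Proof.
move=> ab; apply: (@continuous_FTC2 _ _ (fun y => s * (c * y - y ^+ 2 / 2))) => //.
- apply: continuous_subspaceT => x; apply: cvgM; first exact: cvg_cst.
  by apply: cvgB; [exact: cvg_cst|exact: cvg_id].
- have ct x : {for x, continuous (fun y : R => s * (c * y - y ^+ 2 / 2))}.
    apply: differentiable_continuous; apply/derivable1_diffP.
    by have := quad_derive s c x; case.
  split.
  + by move=> x _; have := quad_derive s c x; case.
  + by apply: cvg_at_right_filter; exact: ct.
  + by apply: cvg_at_left_filter; exact: ct.
- by move=> x _; rewrite derive1E; have := quad_derive s c x; case.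
Qed.

(** The area of a right isosceles triangle with legs [`|c|]. *)
Lemma integral_kink c : (\int[mu]_e (kink c e)%:E = (c ^+ 2 / 2)%:E)%E.
Proof.
have [c0|c0|->] := ltgtP c 0.
- transitivity (\int[mu]_(e in `[c, 0%R]) (- 1 * (c - e))%:E)%E.
    rewrite [RHS]integral_mkcond; apply: eq_integral => e _.
    rewrite patchE mem_setE in_itv/= /kink; case: (ltP 0 e) => e0.
      by rewrite andbF max_r//; lra.
    rewrite andbT; case: (leP c e) => ce.
      by rewrite max_l; [congr EFin; ring|lra].
    by rewrite max_r//; lra.
  by rewrite quad_FTC// -EFinB; congr EFin; field.
- transitivity (\int[mu]_(e in `]0%R, c]) (1 * (c - e))%:E)%E.
    rewrite [RHS]integral_mkcond; apply: eq_integral => e _.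
    rewrite patchE mem_setE in_itv/= /kink; case: (ltP 0 e) => e0 /=.
      case: (leP e c) => ce.
        by rewrite max_l; [congr EFin; ring|lra].
      by rewrite max_r//; lra.
    by rewrite max_r//; lra.
  rewrite integral_itv_obnd_cbnd; last first.
    apply/measurable_EFinP; apply: measurable_funTS.
    by apply: measurable_funM => //; exact: measurable_funB.
  by rewrite quad_FTC// -EFinB; congr EFin; field.
- rewrite integral0_eq; first by congr EFin; rewrite expr0n mul0r.
  by move=> e _; rewrite /kink subr0 sub0r; case: ifPn => e0; rewrite max_r//; [lra|rewrite leNgt].
Qed.

End Kink.

(** * Curvature of the smoothed loss under a Lipschitz density *)

Section ExcessLoss.
Context {R : realType}.
Notation mu := (@lebesgue_measure R).
Variables (tau h kappa1 kappa2 kappau : R) (K : R -> R).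
Hypothesis tau01 : 0 < tau < 1.
Hypothesis h0 : 0 < h.
Hypothesis HK : kernel_assumption K kappa1 kappa2 kappau.

Let mK := kernel_measurable HK.
Let K0 := kernel_ge0 HK.
Let L := smoothed_loss tau K h.

(** The increment of the smoothed loss without its linear part, whose mean given
    the design vanishes by the quantile condition ([quantile_orthogonal]). *)
Definition excess_loss v e : R := L (e - v) - L e - v * ((e <= 0)%R%:R - tau).

Let gap v s e : R := kink (v - h * s) e - kink (- (h * s)) e.

Let gap_le v s e : `|gap v s e| <=
  `|v| * \1_(`[- (`|v| + h * `|s|), `|v| + h * `|s|]) e.
Proof.
have hs : `|h * s| = h * `|s| by rewrite normrM gtr0_norm.
have := @kink_diff_le _ (- (h * s)) (v - h * s) (`|v| + h * `|s|) e.
rewrite normrN hs opprK subrK; apply; first by rewrite lerDr.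
by apply: le_trans (ler_normB _ _) _; rewrite hs.
Qed.

Let gap_le1 v s e : `|gap v s e| <= `|v|.
Proof.
apply: le_trans (gap_le v s e) _; rewrite indicE.
by case: (e \in _); rewrite ?mulr1// mulr0.
Qed.

Let measurable_gap v : measurable_fun [set: R * R] (fun z => gap v z.1 z.2).
Proof.
have mhs : measurable_fun [set: R * R] (fun z => h * z.1).
  by apply: measurable_funM.
apply: measurable_funB.
  by apply: measurable_kink => //; exact: measurable_funB.
by apply: measurable_kink => //; exact: measurable_funN.
Qed.

Let mgap1 v e : measurable_fun [set: R] (gap v ^~ e).
Proof. exact: (measurableT_comp (measurable_gap v) (@pair2_measurable _ _ R R e)). Qed.

Let mgap2 v s : measurable_fun [set: R] (gap v s).
Proof. exact: (measurableT_comp (measurable_gap v) (@pair1_measurable _ _ R R s)). Qed.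

Let igap v e : mu.-integrable [set: R] (EFin \o (fun s => gap v s e * K s)).
Proof.
apply: (integrable_kernel_growth HK (a := `|v|) (b := 0) (c := 0)).
  exact: mgap1.
by move=> s; rewrite !mul0r !addr0; exact: gap_le1.
Qed.

(** Knight's identity for the shifts [v - h * s] and [- (h * s)]: the difference
    of their linear parts does not depend on [s] and is the term subtracted in
    [excess_loss]. *)
Lemma excess_lossE v e : excess_loss v e = \int[mu]_s (gap v s e * K s).
Proof.
rewrite /excess_loss /L (smoothed_loss_diff tau01 h0 HK).
set k := (_ - tau).
have -> : \int[mu]_s ((check_loss tau (e - v + h * s) - check_loss tau (e + h * s)) * K s)
  = \int[mu]_s (v * k * K s + gap v s e * K s).
  apply: eq_Rintegral => s _; rewrite -mulrDl; congr (_ * _).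
  have -> : e - v + h * s = e - (v - h * s) by ring.
  have -> : e + h * s = e - (- (h * s)) by ring.
  rewrite -[LHS](subrKA (check_loss tau e)) -[check_loss tau e - _]opprB.
  rewrite !check_loss_kink /gap -/k; ring.
have iK : mu.-integrable [set: R] (EFin \o (fun s => v * k * K s)).
  rewrite /comp; under eq_fun do rewrite EFinM.
  by apply: integrableZl => //; exact: integrable_kernel HK.
rewrite RintegralD// RintegralZl//; last exact: integrable_kernel HK.
by rewrite (kernel_integral1 HK) mulr1 addrAC subrr add0r.
Qed.

Lemma excess_loss_le v e : `|excess_loss v e| <= `|v|.
Proof.
rewrite excess_lossE; apply: le_trans (le_normr_Rintegral _ (igap v e)) _ => //.
apply: (@le_trans _ _ (\int[mu]_s (`|v| * K s))).
  apply: le_Rintegral => //.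
  - exact: integrable_norm (igap v e).
  - rewrite /comp; under eq_fun do rewrite EFinM.
    by apply: integrableZl => //; exact: integrable_kernel HK.
  - by move=> s _; rewrite normrM [`|K s|]ger0_norm// ler_wpM2r// gap_le1.
by rewrite RintegralZl ?(kernel_integral1 HK) ?mulr1//; exact: integrable_kernel HK.
Qed.

Lemma measurable_excess_loss d (T : measurableType d) (v e : T -> R) :
  measurable_fun [set: T] v -> measurable_fun [set: T] e ->
  measurable_fun [set: T] (fun z => excess_loss (v z) (e z)).
Proof.
move=> mv me; have mL := measurable_smoothed_loss tau01 h0 HK.
apply: measurable_funB; first apply: measurable_funB.
- by apply: (measurableT_comp mL); exact: measurable_funB.
- exact: (measurableT_comp mL).
- apply: measurable_funM => //; apply: measurable_funB => //.
  rewrite (_ : (fun z => _) = (fun z => if e z <= 0 then 1 else 0)); last first.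
    by apply/funext => z; case: (e z <= 0).
  by apply: measurable_fun_ifT => //; exact: measurable_fun_ler.
Qed.

Let gap_window v s (om : R -> R) c : (forall e, 0 <= om e) -> measurable_fun [set: R] om ->
  (forall e, `|e| <= `|v| + h * `|s| -> om e <= c) ->
  (\int[mu]_e (om e * `|gap v s e|)%:E <= (2 * c * `|v| * (`|v| + h * `|s|))%:E)%E.
Proof.
move=> om0 mom omc; set M := `|v| + h * `|s|.
have M0 : 0 <= M by rewrite addr_ge0// mulr_ge0// ltW.
apply: (@le_trans _ _ (\int[mu]_e (c * `|v| * \1_(`[- M, M]) e)%:E)%E).
  apply: ge0_le_integral => //.
  - by move=> e _; rewrite lee_fin mulr_ge0.
  - apply/measurable_EFinP; apply: measurable_funM => //.
    by apply: measurableT_comp => //; exact: mgap2.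
  - by apply/measurable_EFinP; apply: measurable_funM => //; exact: measurable_indic.
  - move=> e _; rewrite lee_fin -mulrA.
    have := gap_le v s e; rewrite -/M indicE mem_setE in_itv/= -ler_norml.
    case: (leP `|e| M) => eM /= ge.
      by apply: ler_pM => //; exact: omc.
    move: ge; rewrite !mulr0 normr_le0 => /eqP ->.
    by rewrite normr0 mulr0.
have c0 : 0 <= c by apply: le_trans (om0 0) (omc 0 _); rewrite normr0.
under eq_integral do rewrite EFinM.
rewrite ge0_integralZl//; last 2 first.
- by apply/measurable_EFinP; exact: measurable_indic.
- by rewrite lee_fin mulr_ge0.
have muM : (mu `[(- M)%R, M]%classic = (2 * M)%:E)%E.
  rewrite lebesgue_measure_itv/= lte_fin; case: ltP => MM.
    by rewrite -EFinD opprK; congr EFin; ring.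
  have -> : M = 0 by lra.
  by rewrite mulr0.
apply: (@le_trans _ _ ((c * `|v|)%:E * mu `[(- M)%R, M]%classic)%E).
  by rewrite integral_indic// setIT.
by rewrite muM -EFinM lee_fin; lra.
Qed.

Let kernel_quad v : \int[mu]_s ((`|v| + h * `|s|) ^+ 2 * K s) <=
  2 * (v ^+ 2 + h ^+ 2 * kappa2).
Proof.
have i0 : mu.-integrable [set: R] (EFin \o (fun s => 2 * v ^+ 2 * K s)).
  rewrite /comp; under eq_fun do rewrite EFinM.
  by apply: integrableZl => //; exact: integrable_kernel HK.
have i2 : mu.-integrable [set: R] (EFin \o (fun s => 2 * h ^+ 2 * (`|s| ^+ 2 * K s))).
  rewrite /comp; under eq_fun do rewrite EFinM.
  by apply: integrableZl => //; exact: integrable_kernel2 HK.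
have bd s : (`|v| + h * `|s|) ^+ 2 <= 2 * v ^+ 2 + 2 * h ^+ 2 * `|s| ^+ 2.
  rewrite -[v ^+ 2]real_normK ?num_real//.
  have := sqr_ge0 (`|v| - h * `|s|); lra.
have m2 : measurable_fun [set: R] (fun s : R => (`|v| + h * `|s|) ^+ 2).
  apply: measurable_funX; apply: measurable_funD => //; apply: measurable_funM => //.
have iq : mu.-integrable [set: R] (EFin \o (fun s => (`|v| + h * `|s|) ^+ 2 * K s)).
  apply: (integrable_kernel_growth HK (a := 2 * v ^+ 2) (b := 0) (c := 2 * h ^+ 2)) => // s.
  by rewrite mul0r addr0 ger0_norm ?sqr_ge0.
apply: (@le_trans _ _ (\int[mu]_s (2 * v ^+ 2 * K s + 2 * h ^+ 2 * (`|s| ^+ 2 * K s)))).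
  apply: le_Rintegral => //.
  - by rewrite /comp; under eq_fun do rewrite EFinD; exact: integrableD.
  - by move=> s _; rewrite [2 * h ^+ 2 * _]mulrA -mulrDl ler_wpM2r.
have iK0 := integrable_kernel HK; have iK2 := integrable_kernel2 HK.
rewrite RintegralD// !RintegralZl//.
rewrite (kernel_integral1 HK) (kernel_integral2 HK).
lra.
Qed.

Let mgapK v : measurable_fun [set: R * R] (fun z => gap v z.1 z.2 * K z.1).
Proof. by apply: measurable_funM => //; exact: measurableT_comp. Qed.

Let excessE v e : ((excess_loss v e)%:E = \int[mu]_s (gap v s e * K s)%:E)%E.
Proof.
by rewrite excess_lossE /Rintegral fineK//; exact: integrable_fin_num (igap v e).
Qed.

(** By [gap_le] the gap at [s] has height at most [`|v|] and lives on a window of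
    half-length [`|v| + h * `|s|], on which the weight [om] is at most [cf s];
    Tonelli exchanges the two integrals.  The weight [`|e|] yields
    [excess_abs_moment], and the weight 1 the integrability behind Fubini's
    theorem in [excess_integral]. *)
Let excess_window v (om cf : R -> R) : (forall e, 0 <= om e) ->
  measurable_fun [set: R] om ->
  (forall s e, `|e| <= `|v| + h * `|s| -> om e <= cf s) ->
  measurable_fun [set: R] cf ->
  (\int[mu]_e (om e * `|excess_loss v e|)%:E <=
   \int[mu]_s (2 * `|v| * (cf s * (`|v| + h * `|s|) * K s))%:E)%E /\
  (\int[mu]_s \int[mu]_e (om e * `|gap v s e| * K s)%:E <=
   \int[mu]_s (2 * `|v| * (cf s * (`|v| + h * `|s|) * K s))%:E)%E.
Proof.
move=> om0 mom omc mcf.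
have mom2 : measurable_fun [set: R * R] (fun z => om z.2) by exact: measurableT_comp.
have mF : measurable_fun [set: R * R]
    (fun z => (om z.2 * `|gap v z.1 z.2| * K z.1)%:E).
  apply/measurable_EFinP; apply: measurable_funM; last exact: measurableT_comp.
  by apply: measurable_funM => //; exact: measurableT_comp.
have F0 z : (0 <= (om z.2 * `|gap v z.1 z.2| * K z.1)%:E)%E.
  by rewrite lee_fin !mulr_ge0.
have mcM : measurable_fun [set: R] (fun s => cf s * (`|v| + h * `|s|) * K s).
  apply: measurable_funM => //; apply: measurable_funM => //.
  by apply: measurable_funD => //; apply: measurable_funM.
suff second : (\int[mu]_s \int[mu]_e (om e * `|gap v s e| * K s)%:E <=
   \int[mu]_s (2 * `|v| * (cf s * (`|v| + h * `|s|) * K s))%:E)%E.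
  split => //; apply: le_trans second.
  have /= -> := fubini_tonelli (m1 := mu) (m2 := mu) _ mF F0.
  apply: ge0_le_integral => //.
  - by move=> e _; rewrite lee_fin mulr_ge0.
  - apply/measurable_EFinP; apply: measurable_funM => //.
    by apply: measurableT_comp => //; exact: measurable_excess_loss.
  - exact: (measurable_fun_fubini_tonelli_G (m1 := mu) _ mF F0).
  move=> e _ /=; under eq_integral do rewrite -mulrA EFinM.
  rewrite ge0_integralZl//; last 3 first.
  + apply/measurable_EFinP; apply: measurable_funM => //.
    by apply: measurableT_comp => //; exact: mgap1.
  + by move=> s _; rewrite lee_fin mulr_ge0.
  + by rewrite lee_fin.
  rewrite EFinM lee_wpmul2l ?lee_fin//.
  rewrite -abse_EFin excessE; apply: le_trans (le_abse_integral _ _ _) _ => //.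
    by apply/measurable_EFinP; apply: measurable_funM => //; exact: mgap1.
  by under eq_integral do rewrite abse_EFin normrM [`|K _|]ger0_norm//.
apply: ge0_le_integral => //.
- by move=> s _; apply: integral_ge0 => e _; rewrite lee_fin !mulr_ge0.
- exact: (measurable_fun_fubini_tonelli_F (m2 := mu) _ mF F0).
- by apply/measurable_EFinP; exact: measurable_funM.
move=> s _; under eq_integral do rewrite EFinM.
rewrite ge0_integralZr//; last 3 first.
- apply/measurable_EFinP; apply: measurable_funM => //.
  by apply: measurableT_comp => //; exact: mgap2.
- by move=> e _; rewrite lee_fin mulr_ge0.
- by rewrite lee_fin.
have := gap_window (v := v) (s := s) (c := cf s) om0 mom (fun e => omc s e) => gw.
apply: le_trans (lee_wpmul2r _ gw) _; first by rewrite lee_fin.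
rewrite -EFinM lee_fin le_eqVlt; apply/orP; left; apply/eqP; ring.
Qed.

Lemma excess_abs_moment v :
  (\int[mu]_e (`|e| * `|excess_loss v e|)%:E <=
   (4 * `|v| * (v ^+ 2 + h ^+ 2 * kappa2))%:E)%E.
Proof.
have [|||| h1 _] := @excess_window v (fun e => `|e|) (fun s => `|v| + h * `|s|); rewrite //.
  by apply: measurable_funD => //; apply: measurable_funM.
apply: le_trans h1 _.
have m2 : measurable_fun [set: R] (fun s : R => (`|v| + h * `|s|) ^+ 2).
  apply: measurable_funX; apply: measurable_funD => //; apply: measurable_funM => //.
have iq : mu.-integrable [set: R] (EFin \o (fun s => (`|v| + h * `|s|) ^+ 2 * K s)).
  apply: (integrable_kernel_growth HK (a := `|v| ^+ 2) (b := 2 * h * `|v|) (c := h ^+ 2)) => // s.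
  rewrite ger0_norm ?sqr_ge0//; lra.
under eq_integral do rewrite EFinM -expr2.
rewrite integralZl//.
rewrite -[X in (_ * X)%E]fineK; last exact: integrable_fin_num iq.
rewrite -EFinM lee_fin.
have := ler_wpM2l (_ : 0 <= 2 * `|v|) (kernel_quad v).
rewrite mulr_ge0// => /(_ isT); rewrite /Rintegral; lra.
Qed.

Let linear_window (v : R) : (\int[mu]_s (2 * `|v| * (1 * (`|v| + h * `|s|) * K s))%:E < +oo)%E.
Proof.
have mM : measurable_fun [set: R] (fun s : R => 1 * (`|v| + h * `|s|)).
  by apply: measurable_funM => //; apply: measurable_funD => //; apply: measurable_funM.
have iq : mu.-integrable [set: R] (EFin \o (fun s => 1 * (`|v| + h * `|s|) * K s)).
  apply: (integrable_kernel_growth HK (a := `|v|) (b := h) (c := 0)) => // s.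
  by rewrite mul1r mul0r addr0 ger0_norm// addr_ge0// mulr_ge0// ltW.
under eq_integral do rewrite EFinM; rewrite integralZl//.
by rewrite -[X in (_ * X)%E]fineK ?ltry//; exact: integrable_fin_num iq.
Qed.

Let excess_window1 v := @excess_window v (cst 1) (cst 1)
  (fun=> ler01) (measurable_cst _) (fun _ _ _ => lexx 1) (measurable_cst _).

Lemma integrable_excess v : mu.-integrable [set: R] (EFin \o excess_loss v).
Proof.
apply/integrableP; split.
  by apply/measurable_EFinP; exact: measurable_excess_loss.
have [h1 _] := excess_window1 v; apply: le_lt_trans (linear_window v).
by apply: le_trans h1; under [leRHS]eq_integral do rewrite mul1r.
Qed.

(** Integrated over [e], the gap at [s] is [v ^+ 2 / 2 - v * h * s], and the
    symmetry of the kernel removes the second term: under a constant density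
    smoothing does not alter the curvature. *)
Lemma excess_integral v : \int[mu]_e excess_loss v e = v ^+ 2 / 2.
Proof.
have iF : (mu \x mu)%E.-integrable [set: R * R]
    (fun z => (gap v z.1 z.2 * K z.1)%:E).
  apply/integrable12ltyP; first by apply/measurable_EFinP; exact: mgapK.
  have [_ h2] := excess_window1 v; apply: le_lt_trans (linear_window v).
  apply: le_trans h2; rewrite le_eqVlt; apply/orP; left; apply/eqP.
  apply: eq_integral => s _; apply: eq_integral => e _.
  by rewrite /= normrM mul1r [`|K s|]ger0_norm.
rewrite /Rintegral; under eq_integral do rewrite excessE.
have /= <- := Fubini iF.
have gapI s : (\int[mu]_e (gap v s e * K s)%:E = ((v ^+ 2 / 2 - v * h * s) * K s)%:E)%E.
  have ik c : mu.-integrable [set: R] (EFin \o kink c).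
    apply/integrableP; split.
      by apply/measurable_EFinP; exact: measurable_kink.
    under eq_integral => e _.
      rewrite /= ger0_norm; last by rewrite /kink; case: ifP => _; rewrite le_max lexx orbT.
      over.
    by rewrite integral_kink ltry.
  under eq_integral do rewrite EFinM.
  rewrite integralZr//; last first.
    rewrite /gap; under eq_fun do rewrite EFinB.
    by apply: integrableB => //; exact: ik.
  rewrite /gap; under eq_integral do rewrite EFinB.
  rewrite integralB//; [|exact: ik|exact: ik].
  by rewrite !integral_kink -EFinB -EFinM; congr EFin; field.
under eq_integral do rewrite gapI.
have -> : (fine (\int[mu]_s ((v ^+ 2 / 2 - v * h * s) * K s)%:E)%E) =
    \int[mu]_s (v ^+ 2 / 2 * K s - v * h * (s * K s)).
  by congr fine; apply: eq_integral => s _; congr EFin; ring.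
have i0 : mu.-integrable [set: R] (EFin \o (fun s => v ^+ 2 / 2 * K s)).
  rewrite /comp; under eq_fun do rewrite EFinM.
  by apply: integrableZl => //; exact: integrable_kernel HK.
have i1 : mu.-integrable [set: R] (EFin \o (fun s => s * K s)).
  by apply: (integrable_kernel_growth HK (a := 0) (b := 1) (c := 0)) => // s; lra.
have i1' : mu.-integrable [set: R] (EFin \o (fun s => v * h * (s * K s))).
  by rewrite /comp; under eq_fun do rewrite EFinM; exact: integrableZl.
rewrite RintegralB// RintegralZl//; last exact: integrable_kernel HK.
rewrite RintegralZl// (kernel_integral1 HK) (kernel_first_moment HK).
lra.
Qed.

Lemma excess_density_integrable (f : R -> R) (l0 v : R) :
  measurable_fun [set: R] f -> (forall e, `|f e - f 0| <= l0 * `|e|) ->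
  mu.-integrable [set: R] (EFin \o (fun e => excess_loss v e * (f e - f 0))) /\
  `|\int[mu]_e (excess_loss v e * (f e - f 0))| <=
    l0 * (4 * `|v| * (v ^+ 2 + h ^+ 2 * kappa2)).
Proof.
move=> mf fl.
have me : measurable_fun [set: R] (excess_loss v) by exact: measurable_excess_loss.
have l00 : 0 <= l0 by have := fl 1; rewrite normr1 mulr1; apply: le_trans.
have iw : mu.-integrable [set: R] (EFin \o (fun e => `|e| * `|excess_loss v e|)).
  apply/integrableP; split.
    apply/measurable_EFinP; apply: measurable_funM => //.
    exact: measurableT_comp.
  under eq_integral do rewrite /= ger0_norm ?mulr_ge0//.
  by apply: le_lt_trans (excess_abs_moment v) _; rewrite ltry.
have ilw : mu.-integrable [set: R] (EFin \o (fun e => l0 * (`|e| * `|excess_loss v e|))).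
  by rewrite /comp; under eq_fun do rewrite EFinM; exact: integrableZl.
have bd e : `|excess_loss v e * (f e - f 0)| <= l0 * (`|e| * `|excess_loss v e|).
  by rewrite normrM mulrA mulrC; apply: ler_wpM2r.
have mN : measurable_fun [set: R] (fun e => excess_loss v e * (f e - f 0)).
  by apply: measurable_funM => //; exact: measurable_funB.
have iN : mu.-integrable [set: R] (EFin \o (fun e => excess_loss v e * (f e - f 0))).
  apply: (@le_integrable _ _ _ mu _ _ _ _ _ _ ilw) => //.
    exact/measurable_EFinP.
  by move=> e _; rewrite /= lee_fin (le_trans (bd e))// ler_norm.
split => //; apply: le_trans (le_normr_Rintegral _ iN) _ => //.
apply: (@le_trans _ _ (\int[mu]_e (l0 * (`|e| * `|excess_loss v e|)))).
  by apply: le_Rintegral => //; exact: integrable_norm iN.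
rewrite RintegralZl// ler_wpM2l// -lee_fin /Rintegral fineK.
  exact: excess_abs_moment.
exact: integrable_fin_num iw.
Qed.

(** The density is frozen at 0, where [excess_integral] applies; what the Lipschitz
    condition allows it to vary is controlled by [excess_abs_moment]. *)
Lemma excess_loss_curvature (f : R -> R) (l0 v : R) :
  measurable_fun [set: R] f -> (forall e, `|f e - f 0| <= l0 * `|e|) ->
  mu.-integrable [set: R] (EFin \o (fun e => excess_loss v e * f e)) /\
  f 0 * (v ^+ 2 / 2) - l0 * (4 * `|v| * (v ^+ 2 + h ^+ 2 * kappa2)) <=
  \int[mu]_e (excess_loss v e * f e).
Proof.
move=> mf fl; have [iN bN] := excess_density_integrable v mf fl.
have i0 : mu.-integrable [set: R] (EFin \o (fun e => f 0 * excess_loss v e)).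
  rewrite /comp; under eq_fun do rewrite EFinM.
  by apply: integrableZl => //; exact: integrable_excess.
have fE : (fun e => excess_loss v e * f e) =
    (fun e => f 0 * excess_loss v e + excess_loss v e * (f e - f 0)).
  by apply/funext => e; ring.
rewrite fE; split.
  by rewrite /comp; under eq_fun do rewrite EFinD; exact: integrableD.
rewrite RintegralD// RintegralZl//; last exact: integrable_excess.
rewrite excess_integral lerD2l; move: bN; rewrite ler_norml => /andP[+ _].
by [].
Qed.

End ExcessLoss.

(** * Curvature of the population risk *)

Section DensityMeasure.
Context d (T : measurableType d) (R : realType) (m : {measure set T -> \bar R}).
Variable G : T -> R.
Hypothesis mG : measurable_fun [set: T] G.
Hypothesis G0 : forall w, 0 <= G w.

Definition weighted_measure (A : set T) : \bar R := (\int[m]_(w in A) (G w)%:E)%E.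

Let weighted0 : weighted_measure set0 = 0%E.
Proof. by rewrite /weighted_measure integral_set0. Qed.

Let weighted_ge0 A : (0 <= weighted_measure A)%E.
Proof. by apply: integral_ge0 => w _; rewrite lee_fin. Qed.

Let weighted_sigma_additive : semi_sigma_additive weighted_measure.
Proof.
move=> F mF tF mUF; rewrite [X in _ --> X](_ : _ = \sum_(n <oo) weighted_measure (F n))%E.
  by apply: is_cvg_ereal_nneg_natsum => n _; exact: weighted_ge0.
rewrite /weighted_measure ge0_integral_bigcup//.
  by apply: measurable_funTS; exact/measurable_EFinP.
by move=> w _; rewrite lee_fin.
Qed.

HB.instance Definition _ := isMeasure.Build _ _ _ weighted_measure
  weighted0 weighted_ge0 weighted_sigma_additive.

Definition density_measure : {measure set T -> \bar R} := weighted_measure.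

End DensityMeasure.

Section JointLaw.
Context d (T : measurableType d) (R : realType) (P : probability T R).
Context d' (V : measurableType d').
Variables (X : {RV P >-> V}) (eps : {RV P >-> R}) (f : V -> R -> R).
Notation mu := (@lebesgue_measure R).
Hypothesis fX : is_conditional_density X eps f.

Let pairX (w : T) : V * R := (X w, eps w).
Let liftX (z : T * R) : V * R := (X z.1, z.2).

Let mpairX : measurable_fun [set: T] pairX.
Proof. by apply: measurable_fun_pair. Qed.

Let mliftX : measurable_fun [set: T * R] liftX.
Proof. by apply: measurable_fun_pair => //; exact: measurableT_comp. Qed.

Let dens (z : T * R) : R := f (X z.1) z.2.

Let mdens : measurable_fun [set: T * R] dens.
Proof. by case: fX => mf _ _; exact: (measurableT_comp mf mliftX). Qed.

Let dens0 z : 0 <= dens z. Proof. by case: fX => _ f0 _; exact: f0. Qed.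

(** A conditional density determines the joint law on rectangles, and these
    generate the product sigma-algebra. *)
Lemma joint_law (A : set (V * R)) : measurable A ->
  (\int[P]_(w in pairX @^-1` A) 1%:E = \int[P \x mu]_(z in liftX @^-1` A) (dens z)%:E)%E.
Proof.
move=> mA.
pose nu1 : {measure set (V * R) -> \bar R} :=
  measure_function_pushforward__canonical__measure_function_Measure P mpairX.
pose wm := density_measure (P \x mu)%E mdens dens0.
pose nu2 : {measure set (V * R) -> \bar R} :=
  measure_function_pushforward__canonical__measure_function_Measure wm mliftX.
have -> : (\int[P]_(w in pairX @^-1` A) 1%:E = nu1 A)%E.
  rewrite integral_cst ?mul1e//.
  by rewrite -[X in measurable X]setTI; exact: mpairX.
change (nu1 A = nu2 A).
pose C : set (set (V * R)) :=
  [set B | exists B1, measurable B1 /\ exists B2, measurable B2 /\ B = B1 `*` B2].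
apply: (measure_unique C (fun=> setT)) => //.
- rewrite measurable_prod_measurableType //; congr (<<s _ >>).
  rewrite predeqE; split => [[B1 mB1 [B2 mB2 <-]]|[B1 [mB1 [B2 [mB2 ->]]]]].
    by exists B1; split => //; exists B2.
  by exists B1 => //; exists B2.
- move=> _ _ [X1 [mX1 [X2 [mX2 ->]]]] [Y1 [mY1 [Y2 [mY2 ->]]]].
  rewrite -setXI; exists (X1 `&` Y1); split; first exact: measurableI.
  by exists (X2 `&` Y2); split => //; exact: measurableI.
- by move=> _; exists setT; split => //; exists setT; split => //; rewrite setXTT.
- by rewrite bigcup_const//; exists 0%N.
- move=> _ [B1 [mB1 [B2 [mB2 ->]]]].
  have mXB : measurable (X @^-1` B1) by exact: measurable_funPTI.
  transitivity (P (X @^-1` B1 `&` eps @^-1` B2)); first by [].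
  case: fX => _ _ ->//.
  transitivity (\int[P \x mu]_(z in (X @^-1` B1) `*` B2) (dens z)%:E)%E; last by [].
  pose F (z : T * R) : \bar R := (\1_(X @^-1` B1) z.1 * (\1_B2 z.2 * dens z))%:E.
  have -> : (\int[P \x mu]_(z in (X @^-1` B1) `*` B2) (dens z)%:E =
      \int[P \x mu]_z F z)%E.
    rewrite integral_mkcond; apply: eq_integral => z _.
    rewrite patchE in_setX /F !indicE.
    by case: (z.1 \in _); case: (z.2 \in _); rewrite /= ?mul1r ?mul0r ?mulr0.
  have F0 z : (0 <= F z)%E.
    by rewrite lee_fin !mulr_ge0// !indicE.
  have mF : measurable_fun [set: T * R] F.
    apply/measurable_EFinP; apply: measurable_funM.
      exact: (measurableT_comp (@measurable_indic _ _ R setT _ mXB) measurable_fst).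
    apply: measurable_funM => //.
    exact: (measurableT_comp (@measurable_indic _ _ R setT _ mB2) measurable_snd).
  rewrite fubini_tonelli1// integral_mkcond; apply: eq_integral => w _.
  rewrite patchE /fubini_F /F /= indicE; case: ifPn => wB /=.
    rewrite integral_mkcond; apply: eq_integral => e _.
    by rewrite patchE indicE mul1r; case: ifP => _; rewrite ?mul1r ?mul0r.
  by rewrite integral0_eq// => e _; rewrite mul0r.
- move=> _; change (P (pairX @^-1` setT) < +oo)%E.
  by rewrite preimage_setT; exact: fin_num_fun_lty (fin_num_measure P).
Qed.

Lemma joint_expectation (k : V * R -> R) : measurable_fun [set: V * R] k ->
  (\int[P]_w (k (X w, eps w))%:E =
   \int[P \x mu]_z (k (X z.1, z.2) * f (X z.1) z.2)%:E)%E.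
Proof.
move=> mk.
transitivity (\int[P]_w ((EFin \o k) (pairX w) * (cst 1%R w)%:E))%E.
  by apply: eq_integral => w _; rewrite mule1.
apply: (@integral_transfer _ _ R _ T _ _ P (P \x mu)%E pairX liftX (cst 1) dens
  (EFin \o k)) => //.
- exact: joint_law.
- exact/measurable_EFinP.
Qed.

End JointLaw.

Section PopulationRisk.
Context d (T : measurableType d) (R : realType) (P : probability T R).
Context d' (V : measurableType d').
Variables (X : {RV P >-> V}) (eps : {RV P >-> R}) (f : V -> R -> R) (tau : R).
Notation mu := (@lebesgue_measure R).
Hypothesis tau01 : 0 < tau < 1.
Hypothesis fX : is_conditional_density X eps f.
Hypothesis qX : cond_prob_cst X eps `]-oo, 0] tau.

Lemma quantile_orthogonal (v : V -> R) : measurable_fun [set: V] v ->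
  P.-integrable [set: T] (fun w => (v (X w))%:E) ->
  \int[P]_w (v (X w) * ((eps w <= 0)%R%:R - tau)) = 0.
Proof.
move=> mv iv.
have mneg : measurable_fun [set: T] (fun w => (eps w <= 0)%R%:R : R).
  rewrite (_ : (fun w => _) = (fun w => if eps w <= 0 then 1 else 0)); last first.
    by apply/funext => w; case: (eps w <= 0).
  by apply: measurable_fun_ifT => //; exact: measurable_fun_ler.
have mvX : measurable_fun [set: T] (fun w => v (X w)) by exact: measurableT_comp.
have E : (\int[P]_w (v (X w) * (eps w <= 0)%R%:R)%:E = \int[P]_w (v (X w) * tau)%:E)%E.
  have := @integral_transfer _ V R _ T _ T P P X X
    (fun w => (eps w <= 0)%R%:R) (cst tau) (EFin \o v); apply => //.
  - by move=> w /=; case/andP: tau01 => /ltW.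
  - move=> A mA.
    have mXA : measurable (X @^-1` A) by exact: measurable_funPTI.
    have meps : measurable (eps @^-1` `]-oo, 0]) by exact: measurable_funPTI.
    rewrite [RHS](_ : _ = (tau%:E * P (X @^-1` A))%E); last first.
      by apply: etrans (integral_cst _ mXA tau%:E) => //.
    rewrite -qX// setIC -integral_indic//.
    apply: eq_integral => w _; congr EFin; rewrite indicE mem_setE.
    by congr (nat_of_bool _)%:R; rewrite /= in_itv.
  - exact/measurable_EFinP.
have iE : P.-integrable [set: T] (fun w => (v (X w) * (eps w <= 0)%R%:R)%:E).
  apply: (@le_integrable _ _ _ P _ _ _ (fun w => (v (X w))%:E)) => //.
    by apply/measurable_EFinP; exact: measurable_funM.
  move=> w _; rewrite /= lee_fin normrM.
  by case: (eps w <= 0); rewrite ?normr1 ?mulr1// normr0 mulr0.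
have iT : P.-integrable [set: T] (fun w => (v (X w) * tau)%:E).
  by under eq_fun do rewrite EFinM; exact: integrableZr.
under eq_Rintegral do rewrite mulrBr.
by rewrite RintegralB// /Rintegral E subrr.
Qed.

Variables (h kappa1 kappa2 kappau : R) (K : R -> R).
Hypothesis h0 : 0 < h.
Hypothesis HK : kernel_assumption K kappa1 kappa2 kappau.
Variables (flow l0 : R).
Hypothesis l00 : 0 < l0.
Hypothesis flowP : {ae P, forall w, flow <= f (X w) 0}.
Hypothesis lipP : {ae P, forall w, forall u v, `|f (X w) u - f (X w) v| <= l0 * `|u - v|}.

Let L := smoothed_loss tau K h.

(** The linear part of the increment has mean zero; given the design, the rest is
    bounded below by [excess_loss_curvature]. *)
Lemma population_curvature (v : V -> R) : measurable_fun [set: V] v ->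
  (forall k, P.-integrable [set: T] (fun w => (`|v (X w)| ^+ k.+1)%:E)) ->
  flow / 2 * \int[P]_w (`|v (X w)| ^+ 2)
    - 4 * l0 * (\int[P]_w (`|v (X w)| ^+ 3)
                + h ^+ 2 * kappa2 * \int[P]_w (`|v (X w)| ^+ 1))
  <= \int[P]_w (L (eps w - v (X w)) - L (eps w)).
Proof.
move=> mv iv.
pose N := excess_loss tau h K.
have mvX : measurable_fun [set: T] (fun w => v (X w)) by exact: measurableT_comp.
have ivX : P.-integrable [set: T] (fun w => (v (X w))%:E).
  apply: (@le_integrable _ _ _ P _ _ _ (fun w => (`|v (X w)| ^+ 1)%:E)) => //.
    exact/measurable_EFinP.
  by move=> w _; rewrite /= lee_fin expr1 normr_id.
have mk : measurable_fun [set: V * R] (fun z => N (v z.1) z.2).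
  by apply: (measurable_excess_loss tau01 h0 HK) => //; exact: measurableT_comp.
have mNw : measurable_fun [set: T] (fun w => N (v (X w)) (eps w)).
  exact: (measurable_excess_loss tau01 h0 HK).
have iNw : P.-integrable [set: T] (fun w => (N (v (X w)) (eps w))%:E).
  apply: (@le_integrable _ _ _ P _ _ _ (fun w => (v (X w))%:E)) => //.
    exact/measurable_EFinP.
  by move=> w _; rewrite /= lee_fin; exact: (excess_loss_le tau01 h0 HK).
have neg_le w : `|(eps w <= 0)%R%:R - tau| <= 1.
  have /andP[t0 t1] := tau01.
  by rewrite ler_norml; case: (eps w <= 0) => /=; apply/andP; split; lra.
have mneg : measurable_fun [set: T] (fun w => v (X w) * ((eps w <= 0)%R%:R - tau)).
  apply: measurable_funM => //; apply: measurable_funB => //.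
  rewrite (_ : (fun w => _) = (fun w => if eps w <= 0 then 1 else 0)); last first.
    by apply/funext => w; case: (eps w <= 0).
  by apply: measurable_fun_ifT => //; exact: measurable_fun_ler.
have ineg : P.-integrable [set: T]
    (fun w => (v (X w) * ((eps w <= 0)%R%:R - tau))%:E).
  apply: (@le_integrable _ _ _ P _ _ _ (fun w => (v (X w))%:E)) => //.
    exact/measurable_EFinP.
  by move=> w _; rewrite /= lee_fin normrM ler_piMr.
have -> : \int[P]_w (L (eps w - v (X w)) - L (eps w)) = \int[P]_w N (v (X w)) (eps w).
  transitivity (\int[P]_w (N (v (X w)) (eps w) + v (X w) * ((eps w <= 0)%R%:R - tau))).
    by apply: eq_Rintegral => w _; rewrite /N /excess_loss subrK.
  by rewrite RintegralD// quantile_orthogonal// addr0.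
pose g (z : T * R) : \bar R := (N (v (X z.1)) z.2 * f (X z.1) z.2)%:E.
have [mf f0 _] := fX.
have mXz : measurable_fun [set: T * R] (fun z => (X z.1, z.2)).
  by apply: measurable_fun_pair => //; exact: measurableT_comp.
have mg : measurable_fun [set: T * R] g.
  apply/measurable_EFinP; apply: measurable_funM.
    exact: (measurableT_comp mk mXz).
  exact: (measurableT_comp mf mXz).
have ig : (P \x mu)%E.-integrable [set: T * R] g.
  apply/integrableP; split => //.
  have := joint_expectation fX (k := fun z => `|N (v z.1) z.2|)
    (measurableT_comp (@normr_measurable R setT) mk).
  move=> /= E.
  under eq_integral do rewrite /g /= normrM [`|f _ _|]ger0_norm//.
  rewrite -E; have /integrableP[_] := iNw.
  by [].
have EN : (\int[P]_w (N (v (X w)) (eps w))%:E = \int[P]_w fubini_F mu g w)%E.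
  rewrite (joint_expectation fX (k := fun z => N (v z.1) z.2) mk).
  by rewrite integral12_prod_meas1.
pose B (w : T) : R := flow / 2 * `|v (X w)| ^+ 2
    - 4 * l0 * (`|v (X w)| ^+ 3 + h ^+ 2 * kappa2 * `|v (X w)| ^+ 1).
have iZ c k : P.-integrable [set: T] (fun w => (c * `|v (X w)| ^+ k.+1)%:E).
  by under eq_fun do rewrite EFinM; exact: integrableZl.
have iS : P.-integrable [set: T]
    (fun w => (`|v (X w)| ^+ 3 + h ^+ 2 * kappa2 * `|v (X w)| ^+ 1)%:E).
  by under eq_fun do rewrite EFinD; apply: integrableD.
have iSZ : P.-integrable [set: T]
    (fun w => (4 * l0 * (`|v (X w)| ^+ 3 + h ^+ 2 * kappa2 * `|v (X w)| ^+ 1))%:E).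
  by under eq_fun do rewrite EFinM; exact: integrableZl.
have iB : P.-integrable [set: T] (EFin \o B).
  rewrite /comp /B; under eq_fun do rewrite EFinB.
  by apply: integrableB => //; exact: iZ.
have EB : \int[P]_w B w = flow / 2 * \int[P]_w (`|v (X w)| ^+ 2)
    - 4 * l0 * (\int[P]_w (`|v (X w)| ^+ 3)
                + h ^+ 2 * kappa2 * \int[P]_w (`|v (X w)| ^+ 1)).
  rewrite /B RintegralB//; last exact: iZ.
  rewrite RintegralZl//; last exact: iv.
  rewrite RintegralZl// RintegralD//; [|exact: iv|exact: iZ].
  by rewrite RintegralZl//; exact: iv.
pose I w := fine (fubini_F mu g w).
have iF := integrable_fubini_F ig.
have aeI : {ae P, forall w, (B w <= I w) /\ fubini_F mu g w = (I w)%:E}.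
  move: flowP lipP; apply: filterS2 => w fw lw.
  have mfw : measurable_fun [set: R] (f (X w)).
    exact: (measurableT_comp mf (@pair1_measurable _ _ V R (X w))).
  have lw0 e : `|f (X w) e - f (X w) 0| <= l0 * `|e|.
    by have := lw e 0; rewrite subr0.
  have [iw cw] := excess_loss_curvature tau01 h0 HK (v (X w)) mfw lw0.
  have FE : fubini_F mu g w = (I w)%:E.
    rewrite /I fineK//; exact: integrable_fin_num iw.
  split => //; apply: le_trans cw; rewrite /B.
  rewrite -[v (X w) ^+ 2]real_normK ?num_real// expr1.
  have := ler_wpM2r (sqr_ge0 `|v (X w)|) fw; lra.
rewrite -EB [leRHS]/Rintegral EN.
have mI : measurable_fun [set: T] I.
  apply: (measurableT_comp (@fine_measurable R setT measurableT)).
  exact: measurable_int iF.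
have FI : (\int[P]_w fubini_F mu g w = \int[P]_w (I w)%:E)%E.
  apply: ae_eq_integral => //.
  - exact: measurable_int iF.
  - exact/measurable_EFinP.
  - by apply: filterS aeI => w [_ ->].
have iI : P.-integrable [set: T] (EFin \o I).
  apply/integrableP; split; first exact/measurable_EFinP.
  have /integrableP[mF] := iF; congr (_ < +oo)%E; apply: ae_eq_integral => //.
  - exact: measurableT_comp.
  - by apply: measurableT_comp => //; exact/measurable_EFinP.
  - by apply: filterS aeI => w [_ ->].
(* [B w <= I w] is only known almost everywhere, hence the positive part. *)
have : 0 <= \int[P]_w (I w - B w).
  rewrite /Rintegral (_ : (\int[P]_w (I w - B w)%:E)%E =
    (\int[P]_w (Num.max (I w - B w) 0)%:E)%E).
    by rewrite fine_ge0// integral_ge0// => w _; rewrite lee_fin le_max lexx orbT.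
  have mBm : measurable_fun [set: T] B by apply/measurable_EFinP; exact: measurable_int iB.
  apply: ae_eq_integral => //.
  - by apply/measurable_EFinP; exact: measurable_funB.
  - by apply/measurable_EFinP; apply: measurable_maxr => //; exact: measurable_funB.
  - by apply: filterS aeI => w [BI _] _; rewrite max_l// subr_ge0.
by rewrite RintegralB// subr_ge0 FI.
Qed.

End PopulationRisk.

(** * The standardized design *)

Section MatrixRoot.
Context {R : realType} {p : nat}.
Implicit Types A S : 'M[R]_p.

Lemma sqrtmx_spec A : sqrtmx A = 0 \/
  (sqrtmx A)^T = sqrtmx A /\ sqrtmx A *m sqrtmx A = A.
Proof.
rewrite /sqrtmx; case: xgetP => [S -> [ST _ SS]|_]; first by right.
by left.
Qed.

Lemma root_unitmx A S : posdef A -> S^T = S -> S *m S = A -> S \in unitmx.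
Proof.
move=> pA ST SS; rewrite -row_free_unit; apply: inj_row_free => v vS.
apply/eqP; rewrite -trmx_eq0; apply: contraTT isT => vT.
have Sv : S *m v^T = 0 by rewrite -[S]ST -trmx_mul vS trmx0.
by have := pA _ vT; rewrite -SS -mulmxA Sv mulmx0 dotC dot0l ltxx.
Qed.

Lemma invmx_sym S : S^T = S -> (invmx S)^T = invmx S.
Proof. by move=> ST; rewrite trmx_inv ST. Qed.

End MatrixRoot.

Section DesignMoments.
Context d (T : measurableType d) (R : realType) (P : probability T R) (p : nat).
Variable x : {RV P >-> p.-tuple R}.
Notation Sigma := (second_moment x).
Notation S := (sqrtmx Sigma).

Lemma measurable_dot_cvec (a : 'cV[R]_p) :
  measurable_fun [set: p.-tuple R] (fun z => dot a (cvec z)).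
Proof.
apply: measurable_sum => i; apply: measurable_funM => //.
under eq_fun do rewrite mxE.
exact: measurable_tnth.
Qed.

Hypothesis L2x : forall j : 'I_p, P.-integrable setT (fun w => (tnth (x w) j ^+ 2)%:E).

Let ixx i j : P.-integrable [set: T] (fun w => (tnth (x w) i * tnth (x w) j)%:E).
Proof.
have mt k : measurable_fun [set: T] (fun w => tnth (x w) k).
  exact: (measurableT_comp (measurable_tnth k)).
apply: (@le_integrable _ _ _ P _ _ _
  (fun w => (tnth (x w) i ^+ 2)%:E + (tnth (x w) j ^+ 2)%:E)%E) => //.
- by apply/measurable_EFinP; exact: measurable_funM.
- move=> w _; rewrite -EFinD !abse_EFin lee_fin [leRHS]ger0_norm; last first.
    by rewrite addr_ge0 ?sqr_ge0.
  rewrite ler_norml; apply/andP; split.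
    have := sqr_ge0 (tnth (x w) i + tnth (x w) j).
    have := sqr_ge0 (tnth (x w) i); have := sqr_ge0 (tnth (x w) j); lra.
  have := sqr_ge0 (tnth (x w) i - tnth (x w) j).
  have := sqr_ge0 (tnth (x w) i); have := sqr_ge0 (tnth (x w) j); lra.
- exact: integrableD.
Qed.

Lemma second_momentE i j : Sigma i j = \int[P]_w (tnth (x w) i * tnth (x w) j).
Proof. by rewrite mxE unlock. Qed.

Lemma dot_second_moment (a : 'cV[R]_p) :
  \int[P]_w (dot a (cvec (x w)) ^+ 2) = dot a (Sigma *m a).
Proof.
have iZ i j : P.-integrable [set: T]
    (fun w => (a i 0 * a j 0 * (tnth (x w) i * tnth (x w) j))%:E).
  by under eq_fun do rewrite EFinM; exact: integrableZl.
transitivity (\int[P]_w \sum_i \sum_j (a i 0 * a j 0 * (tnth (x w) i * tnth (x w) j))).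
  apply: eq_Rintegral => w _; rewrite expr2 /dot big_distrl; apply: eq_bigr => i _ /=.
  by rewrite big_distrr; apply: eq_bigr => j _ /=; rewrite !mxE; ring.
have E i j : (\int[P]_w (a i 0 * a j 0 * (tnth (x w) i * tnth (x w) j))%:E =
    (a i 0 * a j 0 * Sigma i j)%:E)%E.
  under eq_integral do rewrite EFinM.
  rewrite integralZl// second_momentE [RHS]EFinM; congr (_ * _)%E.
  by rewrite /Rintegral fineK//; exact: integrable_fin_num (ixx i j).
rewrite /Rintegral.
under eq_integral do rewrite -sumEFin.
rewrite integral_sum//; last first.
  move=> i; under eq_fun do rewrite -sumEFin.
  by apply: integrable_sum => // j _; exact: iZ.
rewrite (eq_bigr (fun i => (\sum_j a i 0 * a j 0 * Sigma i j)%:E)) => [|i _]; last first.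
  under eq_integral do rewrite -sumEFin.
  by rewrite integral_sum// -sumEFin; apply: eq_bigr => j _; exact: E.
rewrite sumEFin /=; apply: eq_bigr => i _; rewrite mxE big_distrr.
by apply: eq_bigr => j _ /=; ring.
Qed.

Hypothesis pS : posdef Sigma.
Hypotheses (ST : S^T = S) (SS : S *m S = Sigma).

Let Su : S \in unitmx. Proof. exact: root_unitmx pS ST SS. Qed.

Lemma dot_standardized u w :
  dot u (standardized x w) = dot (invmx S *m u) (cvec (x w)).
Proof. by rewrite /standardized dot_mulmx invmx_sym. Qed.

Lemma measurable_dot_standardized u :
  measurable_fun [set: T] (fun w => dot u (standardized x w)).
Proof.
under eq_fun do rewrite dot_standardized.
exact: (measurableT_comp (measurable_dot_cvec _)).
Qed.

Lemma standardized_second_moment u :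
  \int[P]_w (dot u (standardized x w) ^+ 2) = norm2 u ^+ 2.
Proof.
under eq_Rintegral do rewrite dot_standardized.
rewrite dot_second_moment.
have -> : Sigma *m (invmx S *m u) = S *m u by rewrite -{1}SS -mulmxA mulKVmx.
by rewrite dot_mulmx ST mulKVmx// norm2_sqr.
Qed.

Variable v0 : R.
Hypotheses (v00 : 0 < v0) (sub : subexponential_design x v0).

Let tail u : norm2 u = 1 -> forall s, 0 <= s ->
  (P [set w | (v0 * s <= `|dot u (standardized x w)|)%R] <= (2 * expR (- s))%:E)%E.
Proof. by move=> u1 s s0; exact: sub. Qed.

Let E3 u : ('E_P[fun w => (`|dot u (standardized x w)| ^+ 3)%R] =
  \int[P]_w (`|dot u (standardized x w)| ^+ 3)%:E)%E.
Proof. by rewrite unlock. Qed.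

Let e3_fin u : norm2 u = 1 ->
  ('E_P[fun w => (`|dot u (standardized x w)| ^+ 3)%R] =
   (\int[P]_w (`|dot u (standardized x w)| ^+ 3))%:E)%E.
Proof.
move=> u1; rewrite E3 /Rintegral fineK//.
have i3 := subexp_integrable_pow (measurable_dot_standardized u) v00 (tail u1) 2.
exact: integrable_fin_num i3.
Qed.

Let m3_sup : (0 < p)%N -> ereal_sup [set ('E_P[fun w => (`|dot u (standardized x w)| ^+ 3)%R])%E |
                   u in [set u : 'cV[R]_p | norm2 u = 1]] \is a fin_num.
Proof.
move=> p0; have [e e1] := @norm2_unit_exists R p p0.
rewrite fin_numE; apply/andP; split.
  rewrite gt_eqF//; apply: (@lt_le_trans _ _ ((\int[P]_w (`|dot e (standardized x w)| ^+ 3))%:E)%E).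
    by rewrite ltNyr.
  by apply: ereal_sup_ubound; exists e => //; exact: e3_fin.
rewrite lt_eqF//; apply: (@le_lt_trans _ _ (6 * (4 * v0 * 3%:R) ^+ 3)%:E).
  apply: ge_ereal_sup => _ [u u1 <-]; rewrite e3_fin// lee_fin.
  exact: (subexp_moment (measurable_dot_standardized u) v00 (tail u1) 2).
by rewrite ltry.
Qed.

Lemma standardized_third_moment u : (0 < p)%N -> norm2 u = 1 ->
  \int[P]_w (`|dot u (standardized x w)| ^+ 3) <= m3 x.
Proof.
move=> p0 u1; rewrite -lee_fin /m3 [X in (_ <= X)%E]fineK; last exact: m3_sup.
by apply: ereal_sup_ubound; exists u => //; exact: e3_fin.
Qed.

Let mom2 u : norm2 u = 1 -> \int[P]_w (`|dot u (standardized x w)| ^+ 2) = 1.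
Proof.
move=> u1; under eq_Rintegral do rewrite real_normK ?num_real//.
by rewrite standardized_second_moment u1 expr1n.
Qed.

(** Young's inequality [y ^+ 2 <= 1 / 3 + 2 / 3 * y ^+ 3], integrated against a
    unit second moment. *)
Lemma m3_ge1 : (0 < p)%N -> 1 <= m3 x.
Proof.
move=> p0; have [e e1] := @norm2_unit_exists R p p0.
apply: le_trans (standardized_third_moment p0 e1).
have i k := subexp_integrable_pow (measurable_dot_standardized e) v00 (tail e1) k.
have i1 : P.-integrable [set: T] (EFin \o (fun=> 3^-1 : R)).
  exact: finite_measure_integrable_cst.
have i3 : P.-integrable [set: T]
    (EFin \o (fun w => 2 / 3 * `|dot e (standardized x w)| ^+ 3)).
  by rewrite /comp; under eq_fun do rewrite EFinM; apply: integrableZl => //; exact: i.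
have : \int[P]_w (`|dot e (standardized x w)| ^+ 2) <=
    \int[P]_w (3^-1 + 2 / 3 * `|dot e (standardized x w)| ^+ 3).
  apply: le_Rintegral => //; first exact: i.
    by rewrite /comp; under eq_fun do rewrite EFinD; exact: integrableD.
  move=> w _; set y := `|_|; have y0 : 0 <= y by exact: normr_ge0.
  have : 0 <= (y - 1) ^+ 2 * (2 * y + 1) by rewrite mulr_ge0 ?sqr_ge0//; lra.
  have -> : (y - 1) ^+ 2 * (2 * y + 1) = 2 * y ^+ 3 - 3 * y ^+ 2 + 1 by ring.
  lra.
have i3' := i 2%N; rewrite mom2// RintegralD// [X in _ + X]RintegralZl//.
rewrite Rintegral_cst//.
have -> : fine (P [set: T]) = 1.
  by rewrite -[RHS]/(fine 1%E); congr fine; exact: probability_setT.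
lra.
Qed.

(** The second moment is one, while the tail condition bounds it by
    [6 * (8 * v0) ^+ 2]. *)
Lemma subexp_scale_ge : (0 < p)%N -> 1 <= 20 * v0.
Proof.
move=> p0; have [e e1] := @norm2_unit_exists R p p0.
have := subexp_moment (measurable_dot_standardized e) v00 (tail e1) 1.
rewrite mom2// => h; rewrite leNgt; apply/negP => v1.
have : (4 * v0 * 2) ^+ 2 <= (4 / 10) ^+ 2.
  by apply: lerXn2r; rewrite ?nnegrE ?mulr_ge0 ?ltW//; lra.
lra.
Qed.

End DesignMoments.

(** * Localization *)

Section DensityFloor.
Context d (T : measurableType d) (R : realType) (P : probability T R).
Context d' (V : measurableType d').
Variables (X : {RV P >-> V}) (eps : {RV P >-> R}) (f : V -> R -> R) (flow l0 : R).
Notation mu := (@lebesgue_measure R).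
Hypothesis fX : is_conditional_density X eps f.
Hypotheses (flow0 : 0 < flow) (l00 : 0 < l0).
Hypothesis flowP : {ae P, forall w, flow <= f (X w) 0}.
Hypothesis lipP : {ae P, forall w, forall u v, `|f (X w) u - f (X w) v| <= l0 * `|u - v|}.

(** A density that is at least [flow] at 0 stays above [flow / 2] up to distance
    [flow / (2 * l0)], and its total mass is one. *)
Lemma density_floor_sqr_le : flow ^+ 2 <= 2 * l0.
Proof.
have [mf f0 fP] := fX.
have mass : (\int[P]_w \int[mu]_u (f (X w) u)%:E = 1)%E.
  have := fP setT setT measurableT measurableT.
  by rewrite !preimage_setT setIT => <-; exact: probability_setT.
pose a := flow / (2 * l0).
have a0 : 0 < a by rewrite divr_gt0// mulr_gt0.
have l0a : l0 * a = flow / 2 by rewrite /a; field; rewrite gt_eqF.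
have mF : measurable_fun [set: T * R] (fun z => (f (X z.1) z.2)%:E).
  have mXz : measurable_fun [set: T * R] (fun z => (X z.1, z.2)).
    by apply: measurable_fun_pair => //; exact: measurableT_comp.
  by apply/measurable_EFinP; exact: (measurableT_comp mf mXz).
have F0 (z : T * R) : (0 <= (f (X z.1) z.2)%:E)%E by rewrite lee_fin.
have h : ((flow * a)%:E <= \int[P]_w \int[mu]_u (f (X w) u)%:E)%E.
  have -> : ((flow * a)%:E = \int[P]_w (flow * a)%:E)%E.
    transitivity ((flow * a)%:E * P [set: T])%E; first by rewrite probability_setT mule1.
    by rewrite integral_cst.
  apply: ae_ge0_le_integral => //.
  - by move=> w _; rewrite lee_fin mulr_ge0// ltW.
  - by move=> w _; apply: integral_ge0 => u _; rewrite lee_fin.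
  - exact: (measurable_fun_fubini_tonelli_F (m2 := mu) _ mF F0).
  move: flowP lipP; apply: filterS2 => w fw lw _.
  have mfw : measurable_fun [set: R] (f (X w)).
    exact: (measurableT_comp mf (@pair1_measurable _ _ V R (X w))).
  apply: (@le_trans _ _ (\int[mu]_(u in `[(- a)%R, a]) (flow / 2)%:E)%E).
    rewrite integral_cst//= lebesgue_measure_itv/= lte_fin ifT; last lra.
    by rewrite -EFinD -EFinM lee_fin; lra.
  apply: (@le_trans _ _ (\int[mu]_(u in `[(- a)%R, a]) (f (X w) u)%:E)%E).
    apply: ge0_le_integral => //.
    - by move=> u _; rewrite lee_fin divr_ge0// ltW.
    - by apply/measurable_EFinP; exact: measurable_funTS.
    move=> u; rewrite /= in_itv/= -ler_norml => ua; rewrite lee_fin.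
    have := lw u 0; rewrite subr0 ler_norml => /andP[+ _].
    have : l0 * `|u| <= l0 * a by rewrite ler_pM2l.
    lra.
  apply: ge0_subset_integral => //.
  - exact/measurable_EFinP.
  - by move=> u _; rewrite lee_fin.
move: h; rewrite mass lee_fin /a mulrA ler_pdivrMr; last by rewrite mulr_gt0.
by rewrite mul1r expr2.
Qed.

End DensityFloor.

(** The segment from 0 to a point outside the sphere crosses the sphere, where
    convexity would make [F] nonpositive. *)
Lemma sphere_localization (R : realType) (p : nat) (F : 'cV[R]_p -> R) (r : R) u :
  0 < r -> (forall v s, 0 <= s <= 1 -> F (s *: v) <= s * F v) ->
  (forall v, norm2 v = r -> 0 < F v) -> F u <= 0 -> norm2 u <= r.
Proof.
move=> r0 conv pos Fu; rewrite leNgt; apply/negP => ru.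
have u0 : 0 < norm2 u := lt_trans r0 ru.
have s01 : 0 <= r / norm2 u <= 1.
  apply/andP; split; first by rewrite divr_ge0// ltW.
  by rewrite ler_pdivrMr// mul1r ltW.
have /pos : norm2 ((r / norm2 u) *: u) = r.
  by rewrite norm2Z ger0_norm ?divfK ?gt_eqF// divr_ge0 ?ltW.
rewrite ltNge => /negP; apply; apply: (le_trans (conv _ _ s01)).
by rewrite mulr_ge0_le0//; case/andP: s01.
Qed.

(** The two conditions on the bandwidth enter here.  They give
    [v0 * q * m <= c2 * flow ^+ 2] and [h ^+ 2 * m <= (c2 * flow) ^+ 2], which
    for small [c2] make the cubic term [4 * l0 * m * r ^+ 3] at most half of the
    quadratic term.  The half that is left, [flow / 4 * r ^+ 2], exceeds the
    terms linear in [r] because [r] is their sum over [flow] up to a constant.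
    The bound on [q] follows from the first inequality together with
    [density_floor_sqr_le] and [subexp_scale_ge]. *)
Lemma radius_arithmetic (R : realType) (D flow l0 k2 m M v0 q h c2 r : R) :
  4 <= D -> 0 < flow -> 0 < l0 -> 0 <= k2 -> 1 <= M -> M ^+ 2 = m ->
  1 <= 20 * v0 -> 0 < q -> 0 < h -> 0 < c2 -> flow ^+ 2 <= 2 * l0 ->
  8 * D * (l0 * c2) <= 1 / 40 -> l0 * k2 * c2 <= 1 ->
  v0 * q * M <= h * flow -> h * M <= c2 * flow ->
  flow * r = 8 * D * (v0 * q + l0 * k2 * h ^+ 2) ->
  [/\ q <= 1, 0 < r &
   D * r * v0 * q < flow / 2 * r ^+ 2 - 4 * l0 * (m * r ^+ 3 + h ^+ 2 * k2 * r)].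
Proof.
move=> D4 flow0 l00 k20 M1 M2 v01 q0 h0 c20 flow2 c2l c2k h_lower h_upper rE.
have v00 : 0 < v0 by lra.
have M0 : 0 < M by lra.
have D0 : 0 < D by lra.
have m1 : 1 <= m by rewrite -M2 exprn_ege1.
have vqm : v0 * q * m <= c2 * flow ^+ 2.
  rewrite -M2; apply: (@le_trans _ _ (h * flow * M)).
    by rewrite expr2 mulrA ler_pM2r.
  by rewrite mulrAC expr2 mulrA ler_pM2r.
have h2m : h ^+ 2 * m <= (c2 * flow) ^+ 2.
  rewrite -M2 -exprMn; apply: lerXn2r => //; rewrite nnegrE.
    by rewrite mulr_ge0// ltW.
  by rewrite mulr_ge0// ltW.
have A0 : 0 <= l0 * k2 * h ^+ 2 by rewrite !mulr_ge0 ?sqr_ge0// ltW.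
have B0 : 0 < v0 * q by rewrite mulr_gt0.
have r0 : 0 < r.
  rewrite -(pmulr_rgt0 _ flow0) rE mulr_gt0//; first by lra.
  by rewrite ltr_wpDr.
split => //.
  have vq : v0 * q <= c2 * flow ^+ 2.
    by apply: le_trans vqm; rewrite ler_peMr// ltW.
  have l0c2 : 0 < l0 * c2 by rewrite mulr_gt0.
  have cf : c2 * flow ^+ 2 <= c2 * (2 * l0) by rewrite ler_pM2l.
  have D1 : 32 * (l0 * c2) <= 8 * D * (l0 * c2) by rewrite ler_pM2r//; lra.
  have qv : q <= 20 * v0 * q by rewrite ler_peMl// ltW.
  lra.
have cubic : 4 * l0 * m * r <= flow / 4.
  rewrite -(ler_pM2l flow0).
  have -> : flow * (4 * l0 * m * r) =
      4 * l0 * (8 * D) * (v0 * q * m + l0 * k2 * (h ^+ 2 * m)).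
    have -> : flow * (4 * l0 * m * r) = 4 * l0 * m * (flow * r) by ring.
    by rewrite rE; ring.
  apply: (@le_trans _ _ (4 * l0 * (8 * D) * (c2 * flow ^+ 2 + l0 * k2 * (c2 * flow) ^+ 2))).
    rewrite ler_pM2l; last by rewrite !mulr_gt0.
    by rewrite lerD// ler_wpM2l// mulr_ge0// ltW.
  have -> : 4 * l0 * (8 * D) * (c2 * flow ^+ 2 + l0 * k2 * (c2 * flow) ^+ 2) =
      flow * (flow * (4 * (8 * D * (l0 * c2)) * (1 + l0 * k2 * c2))) by ring.
  rewrite !ler_pM2l//.
  have X0 : 0 <= 8 * D * (l0 * c2).
    by apply: mulr_ge0; [lra|rewrite mulr_ge0// ltW].
  have Y0 : 0 <= l0 * k2 * c2 by rewrite !mulr_ge0// ltW.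
  apply: (@le_trans _ _ (4 * (1 / 40) * (1 + 1))); last by lra.
  apply: ler_pM; [by rewrite mulr_ge0| by rewrite addr_ge0| |by rewrite lerD2l].
  by rewrite ler_pM2l.
have DA : 4 * (l0 * k2 * h ^+ 2) <= D * (l0 * k2 * h ^+ 2) by rewrite ler_wpM2r.
have DB : 0 < D * (v0 * q) by rewrite mulr_gt0.
rewrite -subr_gt0.
have -> : flow / 2 * r ^+ 2 - 4 * l0 * (m * r ^+ 3 + h ^+ 2 * k2 * r) - D * r * v0 * q =
  r * (r * (flow / 2 - 4 * l0 * m * r) - 4 * (l0 * k2 * h ^+ 2) - D * (v0 * q)) by field.
rewrite pmulr_rgt0//.
have : r * (flow / 4) <= r * (flow / 2 - 4 * l0 * m * r) by rewrite ler_pM2l//; lra.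
lra.
Qed.

(** * The empirical risk in standardized coordinates *)

Lemma measurable_wnorm_le d (T : measurableType d) (R : realType) (P : probability T R)
    (p : nat) (S : 'M[R]_p) (b : {RV P >-> p.-tuple R}) (beta : 'cV[R]_p) (c : R) :
  0 <= c -> measurable [set w | norm2 (S *m (cvec (b w) - beta)) <= c].
Proof.
move=> c0.
pose G w := dot (S *m (cvec (b w) - beta)) (S *m (cvec (b w) - beta)).
have mG : measurable_fun [set: T] G.
  have mi i : measurable_fun [set: T] (fun w => (S *m (cvec (b w) - beta)) i 0).
    under eq_fun do rewrite mxE.
    apply: measurable_sum => j; apply: measurable_funM => //.
    under eq_fun do rewrite !mxE.
    apply: measurable_funB => //.
    exact: (measurableT_comp (measurable_tnth j)).
  by apply: measurable_sum => i; exact: measurable_funM.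
have -> : [set w | norm2 (S *m (cvec (b w) - beta)) <= c] = G @^-1` `]-oo, c ^+ 2].
  apply/seteqP; split => w /=; rewrite in_itv/= /G -norm2_sqr.
    by move=> h; apply: lerXn2r => //; rewrite nnegrE norm2_ge0.
  by rewrite ler_pXn2r// nnegrE norm2_ge0.
by rewrite -[X in measurable X]setTI; exact: mG.
Qed.

Section EmpiricalRisk.
Context {R : realType}.
Variables (tau h kappa1 kappa2 kappau : R) (K : R -> R).
Hypothesis tau01 : 0 < tau < 1.
Hypothesis h0 : 0 < h.
Hypothesis HK : kernel_assumption K kappa1 kappa2 kappau.
Variables (p : nat) (S : 'M[R]_p) (beta : 'cV[R]_p).
Hypotheses (ST : S^T = S) (Su : S \in unitmx).
Let L := smoothed_loss tau K h.

Definition feature (z : R * p.-tuple R) : 'cV[R]_p := invmx S *m cvec z.2.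

(** The increment of the loss of one observation in the coordinates
    [u = S *m (b - beta)], in which the covariates are standardized and the
    weighted norm becomes the Euclidean one ([loss_gap_shift]). *)
Definition loss_gap (u : 'cV[R]_p) (z : R * p.-tuple R) : R :=
  L (z.1 - dot (cvec z.2) beta - dot u (feature z)) - L (z.1 - dot (cvec z.2) beta).

Lemma loss_gap0 z : loss_gap 0 z = 0.
Proof. by rewrite /loss_gap dot0l subr0 subrr. Qed.

Lemma loss_gap_lip u u' z :
  `|loss_gap u z - loss_gap u' z| <= `|dot (u - u') (feature z)|.
Proof.
rewrite /loss_gap opprB addrA subrK.
apply: le_trans (smoothed_loss_lip tau01 h0 HK _ _) _.
rewrite dotBl -normrN le_eqVlt; apply/orP; left; apply/eqP; congr (`|_|); ring.
Qed.

Lemma loss_gap_convex v s z : 0 <= s <= 1 ->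
  loss_gap (s *: v) z <= s * loss_gap v z.
Proof.
move=> s01; rewrite /loss_gap; set a := z.1 - _; rewrite dotZl.
have := smoothed_loss_convex tau01 h0 HK (a - dot v (feature z)) a s01.
have -> : s * (a - dot v (feature z)) + (1 - s) * a = a - s * dot v (feature z) by ring.
rewrite -/L; lra.
Qed.

Lemma measurable_dot_feature u :
  measurable_fun [set: R * p.-tuple R] (fun z => dot u (feature z)).
Proof.
rewrite (_ : (fun z => _) = (fun z => dot ((invmx S)^T *m u) (cvec z.2))).
  exact: (measurableT_comp (measurable_dot_cvec _) measurable_snd).
by apply/funext => z; rewrite dot_mulmx.
Qed.

Lemma measurable_loss_gap u : measurable_fun [set: R * p.-tuple R] (loss_gap u).
Proof.
have mL := measurable_smoothed_loss tau01 h0 HK.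
have mb : measurable_fun [set: R * p.-tuple R] (fun z => z.1 - dot (cvec z.2) beta).
  apply: measurable_funB => //.
  under eq_fun do rewrite dotC.
  exact: (measurableT_comp (measurable_dot_cvec _) measurable_snd).
apply: measurable_funB; last exact: (measurableT_comp mL mb).
apply: (measurableT_comp mL); apply: measurable_funB => //.
exact: measurable_dot_feature.
Qed.

Lemma loss_gap_shift (b : 'cV[R]_p) z :
  loss_gap (S *m (b - beta)) z =
  L (z.1 - dot (cvec z.2) b) - L (z.1 - dot (cvec z.2) beta).
Proof.
rewrite /loss_gap /feature dot_mulmx invmx_sym// mulKmx//.
by rewrite [dot (b - _) _]dotC dotBr opprB addrA subrK.
Qed.

End EmpiricalRisk.

(** * The error bound *)

Theorem theorem4p1 (R : realType) :
  exists C : R, 0 < C /\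
  forall tau kappa1 kappa2 kappau l0 : R, 0 < tau < 1 -> 0 < l0 ->
  exists c1 c2 : R, [/\ 0 < c1, 0 < c2 &
  forall (K : R -> R), kernel_assumption K kappa1 kappa2 kappau ->
  forall (p n : nat), (2 <= p)%N -> (1 <= n)%N ->
  forall (d : measure_display) (T : measurableType d) (P : probability T R)
    (x : {RV P >-> p.-tuple R}) (eps y : {RV P >-> R}) (beta : 'cV[R]_p)
    (f : p.-tuple R -> R -> R) (flow upsilon0 : R)
    (ys : 'I_n -> {RV P >-> R}) (xs : 'I_n -> {RV P >-> p.-tuple R}),
  design_assumption x ->
  (forall w, y w = dot (cvec (x w)) beta + eps w) ->
  cond_prob_cst x eps `]-oo, 0] tau ->
  is_conditional_density x eps f ->
  0 < flow -> density_assumption x f flow l0 ->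
  0 < upsilon0 -> subexponential_design x upsilon0 ->
  iid_copies P (fun w => (y w, x w)) (fun i w => (ys i w, xs i w)) ->
  forall (t h : R) (bhat : {RV P >-> p.-tuple R}),
  0 < t ->
  c1 * flow^-1 * Num.sqrt (m3 x) * upsilon0 * Num.sqrt ((p%:R + t) / n%:R)
    <= h ->
  h <= c2 * flow * (Num.sqrt (m3 x))^-1 ->
  is_sqr_estimator tau K h ys xs bhat ->
  ((1 - 2 * expR (- t))%:E <=
   P [set w |
      (wnorm (second_moment x) (cvec (bhat w) - beta) <=
      C / flow *
      (upsilon0 * Num.sqrt ((log2 h^-1 + p%:R + t) / n%:R)
       + l0 * kappa2 * h ^+ 2))%R])%E].
Proof.
have le_mean_sqr (s : R) : s <= (s ^+ 2 + 1) / 2.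
  by have := sqr_ge0 (s - 1); lra.
(* The constant of [uniform_deviation]. *)
pose D : R := 4 * (2 * dev_cst + 32).
have D4 : 4 <= D by rewrite /D /dev_cst; lra.
have D0 : 0 < D by lra.
exists (8 * D); split; first by lra.
move=> tau kappa1 kappa2 kappau l0 tau01 l00.
have D0' := ltW D0; have l00' := ltW l00.
have k21 : 0 < 1 + `|kappa2| by rewrite ltr_wpDr.
have l01 : 0 < 1 + l0 by lra.
(* Small enough for the two bounds [c2l] and [c2k] below.  The constants come
   before the kernel, which alone shows that [kappa2] is nonnegative. *)
pose c2 : R := (40 * (8 * D) * (1 + l0) * (1 + `|kappa2|))^-1.
have den0 : 0 < 40 * (8 * D) * (1 + l0) * (1 + `|kappa2|).
  by do 3 (apply: mulr_gt0 => //); lra.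
have c20 : 0 < c2 by rewrite invr_gt0.
exists 1, c2; split => //.
move=> K HK p n p2 n1 d T P x eps y beta f flow v0 ys xs design yE qX fX flow0.
move=> [flowP lipP] v00 sub iid t h bhat t0 hlo hup est.
have p0 : (0 < p)%N by exact: leq_trans p2.
have [icpt L2x ctr pS] := design.
have nR : 0 < n%:R :> R by rewrite ltr0n.
have pR : 0 < p%:R :> R by rewrite ltr0n.
have k20 : 0 <= kappa2.
  rewrite -(kernel_integral2 HK); apply: Rintegral_ge0 => s _.
  by rewrite mulr_ge0 ?exprn_ge0// (kernel_ge0 HK).
have log20 : 0 <= log2 h^-1.
  apply: ln_ge0; rewrite -[leLHS](expRK 1) ler_ln ?posrE ?expR_gt0//.
    by rewrite le_max lexx orbT.
  by rewrite lt_max expR_gt0 orbT.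
set q := Num.sqrt ((p%:R + t) / n%:R).
have q0 : 0 < q by rewrite sqrtr_gt0 divr_gt0// addr_gt0.
set Q := Num.sqrt ((log2 h^-1 + p%:R + t) / n%:R).
have qQ : q <= Q.
  by rewrite ler_wsqrtr// ler_pM2r ?invr_gt0// -addrA lerDr.
have CD : 0 <= 8 * D / flow by apply: divr_ge0; [lra|exact: ltW].
have bound_le : 8 * D / flow * (v0 * q + l0 * kappa2 * h ^+ 2) <=
    8 * D / flow * (v0 * Q + l0 * kappa2 * h ^+ 2).
  apply: ler_wpM2l => //.
  by rewrite lerD2r ler_pM2l.
set r := 8 * D / flow * (v0 * q + l0 * kappa2 * h ^+ 2) in bound_le.
set Rad := 8 * D / flow * (v0 * Q + l0 * kappa2 * h ^+ 2) in bound_le *.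
have r_ge0 : 0 <= r.
  apply: mulr_ge0 => //; apply: addr_ge0; first by apply: mulr_ge0; exact: ltW.
  by apply: mulr_ge0; rewrite ?sqr_ge0// mulr_ge0// ltW.
have Rad0 : 0 <= Rad := le_trans r_ge0 bound_le.
have exp0 := expR_gt0 (- t).
(* Without a square root of the second moment, [sqrtmx] takes its default value
   0, the seminorm vanishes and the bound is trivial. *)
have [S0|[ST SS]] := sqrtmx_spec (second_moment x).
  rewrite (_ : [set w | _] = setT); last first.
    apply/seteqP; split => // w _ /=.
    by rewrite /wnorm S0 mul0mx /norm2 dot0l sqrtr0.
  by rewrite probability_setT lee_fin; lra.
set S := sqrtmx (second_moment x) in ST SS *.
have Su : S \in unitmx := root_unitmx pS ST SS.
have m31 := m3_ge1 L2x pS ST SS v00 sub p0.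
have v01 := subexp_scale_ge L2x pS ST SS v00 sub p0.
have flow2 := density_floor_sqr_le fX flow0 l00 flowP lipP.
set M := Num.sqrt (m3 x) in hlo hup.
have M2 : M ^+ 2 = m3 x by rewrite sqr_sqrtr//; lra.
have M1 : 1 <= M by rewrite -sqrtr1 ler_wsqrtr.
have M0 : 0 < M by lra.
have hlo' : v0 * q * M <= h * flow.
  rewrite -ler_pdivrMr//; apply: le_trans hlo.
  by rewrite le_eqVlt; apply/orP; left; apply/eqP; rewrite /q; ring.
have hup' : h * M <= c2 * flow by rewrite -ler_pdivlMr.
have h0 : 0 < h.
  by rewrite -(pmulr_lgt0 _ flow0); apply: lt_le_trans hlo'; rewrite !mulr_gt0.
have c2l : 8 * D * (l0 * c2) <= 1 / 40.
  rewrite /c2 mulrA ler_pdivrMr//.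
  have : 0 <= D * `|kappa2| by apply: mulr_ge0.
  have : 0 <= D * l0 * `|kappa2| by do 2?[apply: mulr_ge0 => //].
  lra.
have c2k : l0 * kappa2 * c2 <= 1.
  rewrite /c2 ler_pdivrMr// mul1r ger0_norm//.
  have lk : 0 <= l0 * kappa2 by apply: mulr_ge0.
  have : 4 * (l0 * kappa2) <= D * (l0 * kappa2) by rewrite ler_wpM2r.
  have : 0 <= D * kappa2 by apply: mulr_ge0.
  have : 0 <= D * l0 by apply: mulr_ge0.
  lra.
have rE : flow * r = 8 * D * (v0 * q + l0 * kappa2 * h ^+ 2).
  by rewrite /r; field; rewrite gt_eqF.
have [q1 r0 sep] := radius_arithmetic D4 flow0 l00 k20 M1 M2 v01 q0 h0 c20 flow2
  c2l c2k hlo' hup' rE.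
have small : (p%:R + t) / n%:R <= 1.
  have <- : q ^+ 2 = (p%:R + t) / n%:R.
    by rewrite sqr_sqrtr// divr_ge0// ltW// addr_gt0.
  by rewrite exprn_ile1// ltW.
pose Z w := (y w, x w).
pose Zs i w := (ys i w, xs i w).
have mZ : measurable_fun [set: T] Z by apply: measurable_fun_pair.
have mZs i : measurable_fun [set: T] (Zs i) by apply: measurable_fun_pair.
pose g := loss_gap tau h K S beta.
have tail u s : norm2 u = 1 -> 0 <= s ->
    (P [set w | (v0 * s <= `|dot u (feature S (Z w))|)%R] <= (2 * expR (- s))%:E)%E.
  by move=> u1 s0; exact: sub.
have [B [mB PB goodB]] := uniform_deviation mZ mZs iid
  (measurable_loss_gap tau01 h0 HK S beta) (measurable_dot_feature S)
  (loss_gap0 tau h K S beta) (loss_gap_lip tau01 h0 HK S beta) tail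
  p0 n1 v00 r0 t0 small.
have population u : norm2 u = r ->
    flow / 2 * r ^+ 2 - 4 * l0 * (m3 x * r ^+ 3 + h ^+ 2 * kappa2 * r) <=
    \int[P]_w g u (Z w).
  move=> ur; have [e e1 ue] := unit_direction u p0; rewrite ur in ue.
  pose v (a : p.-tuple R) := dot u (invmx S *m cvec a).
  have vE w : v (x w) = dot u (standardized x w) by [].
  have vr w : `|v (x w)| = r * `|dot e (standardized x w)|.
    by rewrite vE ue dotZl normrM gtr0_norm.
  have mv : measurable_fun [set: p.-tuple R] v.
    rewrite /v; under eq_fun do rewrite dot_mulmx.
    exact: measurable_dot_cvec.
  have me := measurable_dot_standardized ST e.
  have ie k := subexp_integrable_pow me v00 (fun s => @sub e s e1) k.
  have iv k : P.-integrable [set: T] (fun w => (`|v (x w)| ^+ k.+1)%:E).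
    under eq_fun do rewrite vr exprMn EFinM.
    by apply: integrableZl => //; exact: ie.
  have e2 : \int[P]_w (`|dot e (standardized x w)| ^+ 2) = 1.
    under eq_Rintegral do rewrite real_normK ?num_real//.
    by rewrite (standardized_second_moment L2x pS ST SS) e1 expr1n.
  have mom k : \int[P]_w (`|v (x w)| ^+ k.+1) =
      r ^+ k.+1 * \int[P]_w (`|dot e (standardized x w)| ^+ k.+1).
    under eq_Rintegral do rewrite vr exprMn.
    by rewrite RintegralZl//; exact: ie.
  have i2D1 :
      P.-integrable [set: T] (fun w => (`|dot e (standardized x w)| ^+ 2 + 1)%:E).
    under eq_fun do rewrite EFinD.
    apply: integrableD; [by []|exact: (ie 1%N)|].
    exact: finite_measure_integrable_cst.
  have e1le : \int[P]_w (`|dot e (standardized x w)| ^+ 1) <= 1.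
    have -> : 1 = \int[P]_w ((`|dot e (standardized x w)| ^+ 2 + 1) / 2) :> R.
      under eq_Rintegral do rewrite mulrC.
      rewrite RintegralZl; [|by []|exact: i2D1].
      rewrite RintegralD; [|by []|exact: (ie 1%N)|exact: finite_measure_integrable_cst].
      rewrite e2 Rintegral_cst// mul1r.
      have PT : fine (P [set: T]) = 1.
        by rewrite -[RHS]/(fine 1%E); congr fine; exact: probability_setT.
      by rewrite PT; lra.
    apply: le_Rintegral => //.
    - exact: (ie 0%N).
    - rewrite (_ : _ \o _ = fun w =>
          (2^-1%:E * (`|dot e (standardized x w)| ^+ 2 + 1)%:E)%E); last first.
        by apply/funext => w /=; rewrite mulrC EFinM.
      by apply: integrableZl; [|exact: i2D1].
  have e3le := standardized_third_moment ST v00 sub p0 e1.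
  have := population_curvature tau01 fX qX h0 HK flowP lipP mv iv.
  have -> : \int[P]_w (smoothed_loss tau K h (eps w - v (x w)) -
      smoothed_loss tau K h (eps w)) = \int[P]_w g u (Z w).
    apply: eq_Rintegral => w _; rewrite /g /loss_gap /= yE.
    by rewrite [_ + eps w]addrC addrK.
  rewrite !mom e2 mulr1 => pc; apply: le_trans pc; rewrite lerD2l lerN2.
  apply: ler_wpM2l; first by apply: mulr_ge0.
  apply: lerD.
    by rewrite [leRHS]mulrC; apply: ler_wpM2l; rewrite ?exprn_ge0// ltW.
  have kh : 0 <= h ^+ 2 * kappa2 by rewrite mulr_ge0// sqr_ge0.
  apply: ler_wpM2l => //; rewrite expr1 -[leRHS]mulr1; apply: ler_wpM2l => //; exact: ltW.
have good w : ~ B w -> wnorm (second_moment x) (cvec (bhat w) - beta) <= Rad.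
  move=> nB; apply: le_trans bound_le; rewrite /wnorm -/S.
  apply: (@sphere_localization _ _ (fun u => n%:R^-1 * \sum_i g u (Zs i w)) r) => //.
  - move=> u s s01; rewrite mulrCA ler_pM2l ?invr_gt0// mulr_sumr.
    by apply: ler_sum => i _; exact: (loss_gap_convex tau01 h0 HK).
  - move=> u ur; apply: lt_le_trans (goodB w u nB ur).
    rewrite subr_gt0; apply: lt_le_trans (population u ur).
    exact: sep.
  have := est w beta; rewrite /smoothed_risk -subr_le0 -mulrBr -sumrB.
  under eq_bigr do
    rewrite -(loss_gap_shift tau h K beta ST Su (cvec (bhat w)) (Zs _ w)).
  by [].
have mW : measurable [set w | wnorm (second_moment x) (cvec (bhat w) - beta) <= Rad].
  exact: measurable_wnorm_le.
apply: (@le_trans _ _ (P (~` B))).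
  rewrite probability_setC//.
  apply: (@le_trans _ _ (1 - (expR (- t))%:E)%E); last by rewrite leeB.
  by rewrite -EFinB lee_fin; lra.
apply: le_measure => //; rewrite ?inE//; first exact: measurableC.
Qed.
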